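(* Let $c\in\mathbb{C}^*$, $z_0\in\mathbb{D}^*$, let $g$ be a holomorphic function on the punctured disc $\mathbb{D}^*$, and let $\phi$ be the multivalued function on $\mathbb{D}^*$ given by $\phi(z)=g(z)+\frac{c}{2\pi i}\ln(z/z_0)$. If the restrictions of $\phi$ to the domains of the form $\mathbb{D}\setminus l^\theta$ are injective, then $g$ cannot have an essential singular point at $0\in\mathbb{C}$.
   Context: $\mathbb{D}\subset\mathbb{C}$ is the unit disc and $\mathbb{D}^*=\mathbb{D}\setminus\{0\}$. For $\theta\in[0,2\pi]$, $l^\theta=\{0\}\cup\{e^{a+i\theta}: a\in\mathbb{R}\}$ is the closed half-line issued from $0$ with argument $\theta$. On each simply connected domain $\mathbb{D}\setminus l^\theta$ a branch of the logarithm, and hence of $\phi$, is well defined; as $\theta$ varies, $\phi$ and the logarithm are continued accordingly. The injectivity assumption is for every $\theta$ and the corresponding branches of $\phi$. (In the paper, $\phi$ is a branch of the developing map of a projective structure on $\mathbb{D}^*$ whose monodromy is the parabolic map $z\mapsto z+c$.) *)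

(* Defs.v *)
From Stdlib Require Export Reals.
From Coquelicot Require Export Coquelicot.
Open Scope R_scope.

Definition Cexp (w : C) : C :=
  (exp (Re w) * cos (Im w), exp (Re w) * sin (Im w)).

Definition C_differentiable (f : C -> C) (z : C) : Prop :=
  @ex_derive C_AbsRing C_NormedModule f z.

(* For open [D] only: [C_differentiable] at [z] refers to a full neighbourhood
   of [z]. *)
Definition holomorphic_on (D : C -> Prop) (f : C -> C) : Prop :=
  forall z : C, D z -> C_differentiable f z.

Definition injective_on (D : C -> Prop) (f : C -> C) : Prop :=
  forall z1 z2 : C, D z1 -> D z2 -> f z1 = f z2 -> z1 = z2.

Definition unit_disc (z : C) : Prop := Cmod z < 1.

Definition punctured_disc (z : C) : Prop := unit_disc z /\ z <> 0%C.

Definition half_line (theta : R) (z : C) : Prop :=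
  z = 0%C \/ exists a : R, z = Cexp (RtoC a + Ci * RtoC theta)%C.

Definition slit_disc (theta : R) (z : C) : Prop :=
  unit_disc z /\ ~ half_line theta z.

(* The branches on [D] of the multivalued function [ln (z / z0)]: continuous
   choices of a logarithm. They are then automatically holomorphic. *)
Definition ln_branch (D : C -> Prop) (z0 : C) (L : C -> C) : Prop :=
  (forall z : C, D z -> @continuous C_UniformSpace C_UniformSpace L z) /\
  (forall z : C, D z -> Cexp (L z) = (z / z0)%C).

Definition phi_branch (D : C -> Prop) (c z0 : C) (g phi : C -> C) : Prop :=
  exists L : C -> C, ln_branch D z0 L /\
    forall z : C, D z -> phi z = (g z + c / (2 * PI * Ci) * L z)%C.

(* Isolated singularities. The value of [f] at [a] itself plays no role:
   [locally'] is the filter of punctured neighbourhoods. *)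
Definition isolated_singularity (f : C -> C) (a : C) : Prop :=
  @locally' C_UniformSpace a (C_differentiable f).

Definition removable_singularity (f : C -> C) (a : C) : Prop :=
  isolated_singularity f a /\
  exists h : C -> C,
    @locally C_UniformSpace a (C_differentiable h) /\
    @locally' C_UniformSpace a (fun z => h z = f z).

Definition pole (f : C -> C) (a : C) : Prop :=
  isolated_singularity f a /\
  filterlim (fun z => Cmod (f z)) (@locally' C_UniformSpace a)
    (Rbar_locally p_infty).

Definition essential_singularity (f : C -> C) (a : C) : Prop :=
  isolated_singularity f a /\ ~ removable_singularity f a /\ ~ pole f a.

(* Main.v *)
Require Import Defs.
From Stdlib Require Import Psatz ClassicalEpsilon Lia.

(** In the coordinate w = ln z the function phi becomes a single-valued
    function F on the half-plane Re w < 0, the sum of g(e^w) and an affine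
    function, and the hypothesis says that F is injective on every horizontal
    strip of height 2 pi ([lifted_injective]). Every disc of radius 2 in the
    half-plane lies in such a strip, so the distortion of F on it is bounded
    by a universal constant ([injective_distortion], a weak and elementary
    form of the Koebe distortion theorem): moving the centre slightly changes
    F by at most a constant times the change over a unit step in any direction.
    Stepping to the left along horizontal lines, |F| is multiplied by at most a
    fixed constant at each step, so |F| grows at most exponentially in
    -Re w ([exponential_growth]). Returning to z, |g| is bounded by a negative
    power of |z| ([polynomial_growth]). Then z^n g extends holomorphically to 0
    for some n, and dividing out the zeros of that extension shows that 0 is a
    removable singularity or a pole of g ([removable_or_pole]).

    The distortion theorem rests on the square root transform: an injective f
    omits, on a disc, a value taken just outside it, so an affine image of f
    has a square root h there; as h never takes opposite values and covers a
    neighbourhood of 1, it omits a neighbourhood of -1, which makes 1 / (h + 1)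
    a bounded function.

    The function theory behind this is derived from Goursat's theorem for
    rectangles ([Goursat]). Applied in the coordinate ln (z - a), it shows that
    circular means do not depend on the radius, whence the maximum principle
    and the Cauchy estimate ([circle_bound_limit], [cauchy_estimate]); these
    give the differentiability of the derivative
    ([derivative_differentiable]), and L-shaped paths give primitives
    ([primitive_on_disc]), hence square roots ([square_root_on_disc]). *)

(** * Complex differentiation *)

(** Complex differentiability with the increment measured by [Cmod] throughout:
    the canonical uniform structure of [C] is that of a product of two lines,
    whose balls are squares, so [is_derive] is awkward to estimate with. *)
Definition cder (f : C -> C) (z d : C) : Prop :=
  forall eps : R, 0 < eps -> exists delta : R, 0 < delta /\
    forall w : C, Cmod (w - z) < delta ->
      Cmod (f w - f z - d * (w - z)) <= eps * Cmod (w - z).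

Lemma cder_is_derive (f : C -> C) (z d : C) :
  cder f z d <-> @is_derive C_AbsRing (AbsRing_NormedModule C_AbsRing) f z d.
Proof.
  split.
  - intros H. split.
    + apply is_linear_scal_l.
    + intros x Hx. apply (@is_filter_lim_locally_unique C_AbsRing
        (AbsRing_NormedModule C_AbsRing)) in Hx. subst x.
      intros eps. destruct (H eps (cond_pos eps)) as [dl [Hd Hw]].
      exists (mkposreal dl Hd). intros w Hb.
      change (Cmod (f w - f z - (w - z) * d) <= eps * Cmod (w - z))%C.
      replace ((w - z) * d)%C with (d * (w - z))%C by ring.
      apply Hw. exact Hb.
  - intros [_ H] eps He.
    destruct (H z (fun P HP => HP) (mkposreal eps He)) as [dl Hd].
    exists dl. split; [apply cond_pos|]. intros w Hw.
    replace (d * (w - z))%C with ((w - z) * d)%C by ring.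
    apply (Hd w). exact Hw.
Qed.

Lemma locally_Cmod (z : C) (P : C -> Prop) :
  @locally C_UniformSpace z P <->
  exists delta : R, 0 < delta /\ forall w, Cmod (w - z) < delta -> P w.
Proof.
  split.
  - intros H. apply locally_C in H. destruct H as [d H].
    exists d. split; [apply cond_pos|]. exact H.
  - intros [d [Hd H]]. apply locally_C. exists (mkposreal d Hd). exact H.
Qed.

Lemma locally'_Cmod (z : C) (P : C -> Prop) :
  @locally' C_UniformSpace z P <->
  exists delta : R, 0 < delta /\
    forall w, Cmod (w - z) < delta -> w <> z -> P w.
Proof.
  unfold locally', within. rewrite locally_Cmod. tauto.
Qed.

(** The two normed modules over [C] carry different uniform structures but the
    same norm, and only the norm enters the differentiability condition. *)
Lemma cder_C_derive (f : C -> C) (z d : C) :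
  cder f z d <-> @is_derive C_AbsRing C_NormedModule f z d.
Proof.
  rewrite cder_is_derive.
  split; intros [_ H]; (split; [apply @is_linear_scal_l|exact H]).
Qed.

Lemma C_differentiable_cder f z :
  C_differentiable f z <-> exists d, cder f z d.
Proof.
  split; intros [d H]; exists d; apply cder_C_derive; exact H.
Qed.

Lemma Cmod_le_Rabs (z : C) : Cmod z <= Rabs (Re z) + Rabs (Im z).
Proof.
  assert (H := Cmod2_alt z).
  apply Rsqr_incr_0_var; [|pose proof (Rabs_pos (Re z)); pose proof (Rabs_pos (Im z)); lra].
  unfold Rsqr. replace (Cmod z * Cmod z) with (Cmod z ^ 2) by ring.
  rewrite H, <- (pow2_abs (Re z)), <- (pow2_abs (Im z)).
  pose proof (Rabs_pos (Re z)); pose proof (Rabs_pos (Im z)). nra.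
Qed.

Lemma Cmod_im_le (z : C) : Rabs (Im z) <= Cmod z.
Proof.
  eapply Rle_trans; [apply Rmax_r|apply (Rmax_Cmod z)].
Qed.

Lemma Cmod_minus_sym (z w : C) : Cmod (z - w) = Cmod (w - z).
Proof. rewrite <- Cmod_opp. f_equal. ring. Qed.

Lemma Cmod_le_add (z w : C) : Cmod z <= Cmod w + Cmod (z - w).
Proof. replace z with (w + (z - w))%C at 1 by ring. apply Cmod_triangle. Qed.

Lemma cder_const (k z : C) : cder (fun _ => k) z 0.
Proof.
  intros e He. exists 1. split; [lra|]. intros w _.
  replace (k - k - 0 * (w - z))%C with (RtoC 0) by ring. rewrite Cmod_0.
  pose proof (Cmod_ge_0 (w - z)). nra.
Qed.

Lemma cder_id (z : C) : cder (fun w => w) z 1.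
Proof.
  intros e He. exists 1. split; [lra|]. intros w _.
  replace (w - z - 1 * (w - z))%C with (RtoC 0) by ring. rewrite Cmod_0.
  pose proof (Cmod_ge_0 (w - z)). nra.
Qed.

Lemma cder_plus f g z a b :
  cder f z a -> cder g z b -> cder (fun w => f w + g w)%C z (a + b)%C.
Proof.
  rewrite !cder_is_derive. intros Hf Hg. exact (is_derive_plus _ _ _ _ _ Hf Hg).
Qed.

Lemma cder_mult f g z a b :
  cder f z a -> cder g z b ->
  cder (fun w => f w * g w)%C z (a * g z + f z * b)%C.
Proof.
  rewrite !cder_is_derive. intros Hf Hg.
  exact (is_derive_mult f g z a b Hf Hg Cmult_comm).
Qed.

Lemma cder_comp f g z a b :
  cder f (g z) a -> cder g z b -> cder (fun w => f (g w)) z (b * a)%C.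
Proof.
  rewrite !cder_is_derive. intros Hf Hg.
  exact (@is_derive_comp C_AbsRing (AbsRing_NormedModule C_AbsRing) f g z a b Hf Hg).
Qed.

Lemma cder_minus f g z a b :
  cder f z a -> cder g z b -> cder (fun w => f w - g w)%C z (a - b)%C.
Proof.
  rewrite !cder_is_derive. intros Hf Hg. exact (is_derive_minus _ _ _ _ _ Hf Hg).
Qed.

Lemma cder_eq f z a b : cder f z a -> a = b -> cder f z b.
Proof. intros H <-. exact H. Qed.

Lemma cder_ext_loc f g z a r :
  0 < r -> (forall w, Cmod (w - z) < r -> f w = g w) ->
  cder f z a -> cder g z a.
Proof.
  intros Hr He H e Hpe. destruct (H e Hpe) as [d [Hd Hw]].
  exists (Rmin d r). split; [apply Rmin_pos; assumption|].
  intros w Hlt. pose proof (Rmin_l d r). pose proof (Rmin_r d r).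
  rewrite <- (He w), <- (He z); [apply Hw; lra| |lra].
  replace (z - z)%C with (RtoC 0) by ring. rewrite Cmod_0. exact Hr.
Qed.

Lemma cder_ext f g z a :
  (forall w, f w = g w) -> cder f z a -> cder g z a.
Proof. intros H. apply (cder_ext_loc f g z a 1); [lra|auto]. Qed.

Definition ccont (f : C -> C) (z : C) : Prop :=
  forall eps : R, 0 < eps -> exists delta : R, 0 < delta /\
    forall w : C, Cmod (w - z) < delta -> Cmod (f w - f z) < eps.

Lemma cder_cont f z a : cder f z a -> ccont f z.
Proof.
  intros H e He. destruct (H 1 Rlt_0_1) as [d [Hd Hw]].
  pose proof (Cmod_ge_0 a) as Ha.
  assert (He' : 0 < e / (Cmod a + 2)) by (apply Rdiv_lt_0_compat; lra).
  exists (Rmin d (e / (Cmod a + 2))).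
  split; [apply Rmin_pos; assumption|].
  intros w Hlt. pose proof (Rmin_l d (e / (Cmod a + 2))).
  pose proof (Rmin_r d (e / (Cmod a + 2))).
  assert (G1 : Cmod (f w - f z - a * (w - z)) <= 1 * Cmod (w - z)) by (apply Hw; lra).
  assert (G2 := Cmod_le_add (f w - f z) (a * (w - z))).
  rewrite Cmod_mult in G2. pose proof (Cmod_ge_0 (w - z)).
  assert (G3 : Cmod (w - z) * (Cmod a + 2) < e).
  { apply (Rmult_lt_reg_r (/ (Cmod a + 2))); [apply Rinv_0_lt_compat; lra|].
    rewrite Rmult_assoc, Rinv_r, Rmult_1_r by lra. unfold Rdiv in *. lra. }
  nra.
Qed.

Lemma cder_inv_id (z : C) : z <> 0%C -> cder (fun w => / w)%C z (- / (z * z))%C.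
Proof.
  intros Hz e He.
  assert (Hm : 0 < Cmod z) by (apply Cmod_gt_0; exact Hz).
  assert (Hc : 0 < e * Cmod z ^ 3 / 2).
  { apply Rdiv_lt_0_compat; [|lra]. apply Rmult_lt_0_compat; [lra|]. apply pow_lt; lra. }
  exists (Rmin (Cmod z / 2) (e * Cmod z ^ 3 / 2)).
  split; [apply Rmin_pos; lra|].
  intros w Hlt. pose proof (Rmin_l (Cmod z / 2) (e * Cmod z ^ 3 / 2)).
  pose proof (Rmin_r (Cmod z / 2) (e * Cmod z ^ 3 / 2)).
  assert (G1 := Cmod_le_add z w). rewrite (Cmod_minus_sym z w) in G1.
  assert (Hw : w <> 0%C) by (apply Cmod_gt_0; lra).
  replace (/ w - / z - - / (z * z) * (w - z))%C
    with ((w - z) * (w - z) / (z * z * w))%C by (field; split; assumption).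
  rewrite Cmod_div, !Cmod_mult
    by (apply Cmult_neq_0; [apply Cmult_neq_0|]; assumption).
  pose proof (Cmod_ge_0 (w - z)) as H2.
  apply (Rmult_le_reg_r (Cmod z * Cmod z * Cmod w)).
  { repeat apply Rmult_lt_0_compat; lra. }
  unfold Rdiv. rewrite Rmult_assoc, Rinv_l, Rmult_1_r by
   (apply Rgt_not_eq; repeat apply Rmult_lt_0_compat; lra).
  apply Rle_trans with (Cmod (w - z) * (e * Cmod z ^ 3 / 2)).
  - apply Rmult_le_compat_l; lra.
  - replace (e * Cmod (w - z) * (Cmod z * Cmod z * Cmod w)) with
     (Cmod (w - z) * (e * Cmod z ^ 2 * Cmod w)) by ring.
    apply Rmult_le_compat_l; [lra|].
    replace (e * Cmod z ^ 3 / 2) with (e * Cmod z ^ 2 * (Cmod z / 2)) by field.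
    apply Rmult_le_compat_l; [|lra]. assert (0 <= Cmod z ^ 2) by (apply pow_le; lra). nra.
Qed.

Lemma cder_inv (f : C -> C) (z a : C) :
  f z <> 0%C -> cder f z a ->
  cder (fun w => / f w)%C z (- a / (f z * f z))%C.
Proof.
  intros Hz H. eapply cder_eq; [apply (cder_comp Cinv f); [apply cder_inv_id, Hz|exact H]|].
  field. exact Hz.
Qed.

Lemma cder_div (f g : C -> C) (z a b : C) :
  g z <> 0%C -> cder f z a -> cder g z b ->
  cder (fun w => f w / g w)%C z ((a * g z - f z * b) / (g z * g z))%C.
Proof.
  intros Hz Hf Hg. eapply cder_eq;
   [apply (cder_mult f (fun w => / g w)%C); [exact Hf|apply cder_inv; eassumption]|].
  field. exact Hz.
Qed.

Lemma cder_pow (n : nat) (z : C) : exists d, cder (fun w => w ^ n)%C z d.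
Proof.
  induction n as [|n [d IH]].
  - exists (RtoC 0). exact (cder_const 1 z).
  - eexists. apply (cder_mult (fun w => w) (fun w => w ^ n)%C); [apply cder_id|exact IH].
Qed.

(** * The exponential function *)

Lemma Cexp_plus (z w : C) : Cexp (z + w) = (Cexp z * Cexp w)%C.
Proof.
  unfold Cexp. destruct z as [a b], w as [c d]. simpl.
  rewrite exp_plus, cos_plus, sin_plus. apply injective_projections; simpl; ring.
Qed.

Lemma Cexp_0 : Cexp 0 = 1%C.
Proof.
  unfold Cexp. simpl. rewrite exp_0, cos_0, sin_0.
  apply injective_projections; simpl; ring.
Qed.

Lemma Cmod_Cexp (z : C) : Cmod (Cexp z) = exp (Re z).
Proof.
  unfold Cmod, Cexp. simpl.
  replace (exp (Re z) * cos (Im z) * (exp (Re z) * cos (Im z) * 1) +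
           exp (Re z) * sin (Im z) * (exp (Re z) * sin (Im z) * 1))
    with (Rsqr (exp (Re z)) * (Rsqr (sin (Im z)) + Rsqr (cos (Im z)))) by (unfold Rsqr; ring).
  rewrite sin2_cos2, Rmult_1_r. apply sqrt_Rsqr. left. apply exp_pos.
Qed.

Lemma Cexp_neq_0 (z : C) : Cexp z <> 0%C.
Proof. apply Cmod_gt_0. rewrite Cmod_Cexp. apply exp_pos. Qed.

Lemma real_der_eps (f : R -> R) (d : R) :
  derivable_pt_lim f 0 d -> forall eps, 0 < eps -> exists delta, 0 < delta /\
   forall h, Rabs h < delta -> Rabs (f h - f 0 - d * h) <= eps * Rabs h.
Proof.
  intros H e He. destruct (H e He) as [dl Hd]. exists dl. split; [apply cond_pos|].
  intros h Hh. destruct (Req_dec h 0) as [->|Hn].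
  - replace (f 0 - f 0 - d * 0) with 0 by ring. rewrite Rabs_R0. lra.
  - specialize (Hd h Hn Hh). rewrite Rplus_0_l in Hd.
    replace (f h - f 0 - d * h) with (((f h - f 0) / h - d) * h) by (field; exact Hn).
    rewrite Rabs_mult. apply Rmult_le_compat_r; [apply Rabs_pos|lra].
Qed.

(** The error splits into the first order errors of the real functions exp, sin
    and cos at 0, each of which is small compared with the modulus. *)
Lemma cder_Cexp_0 : cder Cexp 0 1.
Proof.
  assert (He := real_der_eps exp 1). rewrite exp_0 in He.
  assert (Hs := real_der_eps sin 1). rewrite sin_0 in Hs.
  assert (Hc := real_der_eps cos 0). rewrite cos_0 in Hc.
  intros e Hpe.
  assert (Hpe' : 0 < Rmin (e / 8) 1) by (apply Rmin_pos; lra).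
  pose proof (Rmin_l (e / 8) 1) as Ha. pose proof (Rmin_r (e / 8) 1) as Hb.
  set (k := Rmin (e / 8) 1) in *.
  pose proof (derivable_pt_lim_exp 0) as De. rewrite exp_0 in De.
  pose proof (derivable_pt_lim_sin 0) as Ds. rewrite cos_0 in Ds.
  pose proof (derivable_pt_lim_cos 0) as Dc. rewrite sin_0, Ropp_0 in Dc.
  destruct (He De k Hpe') as [d1 [Hd1 H1]].
  destruct (Hs Ds k Hpe') as [d2 [Hd2 H2]].
  destruct (Hc Dc k Hpe') as [d3 [Hd3 H3]].
  exists (Rmin (Rmin d1 d2) (Rmin d3 (k / 2))).
  assert (0 < k / 2) by lra.
  split; [repeat apply Rmin_pos; assumption|]. intros w Hw.
  pose proof (Rmin_l (Rmin d1 d2) (Rmin d3 (k / 2))).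
  pose proof (Rmin_r (Rmin d1 d2) (Rmin d3 (k / 2))).
  pose proof (Rmin_l d1 d2). pose proof (Rmin_r d1 d2).
  pose proof (Rmin_l d3 (k / 2)). pose proof (Rmin_r d3 (k / 2)).
  replace (w - 0)%C with w in * by ring.
  pose proof (re_le_Cmod w) as Hre. pose proof (Cmod_im_le w) as Him.
  specialize (H1 (Re w) ltac:(lra)). specialize (H2 (Im w) ltac:(lra)).
  specialize (H3 (Im w) ltac:(lra)).
  rewrite Cexp_0.
  eapply Rle_trans; [apply Cmod_le_Rabs|].
  destruct w as [a b]. simpl in *.
  assert (Ea : Rabs (exp a - 1) <= 2 * Rabs a).
  { replace (exp a - 1) with ((exp a - 1 - 1 * a) + a) by ring.
    eapply Rle_trans; [apply Rabs_triang|]. pose proof (Rabs_pos a). nra. }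
  assert (Ex : exp a <= 2).
  { assert (Rabs (exp a - 1) <= 1) by lra. pose proof (Rle_abs (exp a - 1)). lra. }
  pose proof (exp_pos a). pose proof (Rabs_pos a). pose proof (Rabs_pos b).
  assert (G1 : Rabs (exp a * cos b + - (1) + - (1 * a - 0 * b)) <= 3 * k * Cmod (a, b)).
  { replace (exp a * cos b + - (1) + - (1 * a - 0 * b)) with
     ((exp a - 1 - 1 * a) + exp a * (cos b - 1 - 0 * b)) by ring.
    eapply Rle_trans; [apply Rabs_triang|]. rewrite Rabs_mult, (Rabs_pos_eq (exp a)) by lra.
    pose proof (Rabs_pos (cos b - 1 - 0 * b)). nra. }
  assert (G2 : Rabs (exp a * sin b + - 0 + - (1 * b + 0 * a)) <= 3 * k * Cmod (a, b)).
  { replace (exp a * sin b + - 0 + - (1 * b + 0 * a)) with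
     (exp a * (sin b - 0 - 1 * b) + (exp a - 1) * b) by ring.
    eapply Rle_trans; [apply Rabs_triang|]. rewrite !Rabs_mult, (Rabs_pos_eq (exp a)) by lra.
    pose proof (Rabs_pos (sin b - 0 - 1 * b)). 
    assert (Rabs (exp a - 1) * Rabs b <= k * Rabs b) by (apply Rmult_le_compat_r; lra).
    assert (exp a * Rabs (sin b - 0 - 1 * b) <= 2 * (k * Rabs b)) by (apply Rmult_le_compat; lra).
    nra. }
  pose proof (Cmod_ge_0 (a, b)).
  assert (3 * k * Cmod (a, b) <= e / 2 * Cmod (a, b)) by (apply Rmult_le_compat_r; lra).
  lra.
Qed.

Lemma cder_Cexp (z : C) : cder Cexp z (Cexp z).
Proof.
  apply (cder_ext (fun w => Cexp z * Cexp (w - z))%C).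
  { intros w. rewrite <- Cexp_plus. f_equal. ring. }
  eapply cder_eq.
  - apply (cder_mult (fun _ => Cexp z) (fun w => Cexp (w - z))); [apply cder_const|].
    apply (cder_comp Cexp (fun w => w - z)%C).
    + replace (z - z)%C with (RtoC 0) by ring. apply cder_Cexp_0.
    + apply cder_minus; [apply cder_id|apply cder_const].
  - simpl. ring.
Qed.

(** * Integration along lines and the mean value inequality *)

Lemma continuous_RC (u : R -> C) (t : R) :
  (forall eps, 0 < eps -> exists delta, 0 < delta /\
     forall s, Rabs (s - t) < delta -> Cmod (u s - u t) < eps) ->
  @continuous R_UniformSpace C_R_CompleteNormedModule u t.
Proof.
  intros H. apply (filterlim_locally (U := C_UniformSpace)). intros eps.
  destruct (H eps (cond_pos eps)) as [d [Hd Hs]].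
  exists (mkposreal d Hd). intros s Hb.
  apply C_NormedModule_mixin_compat1. apply (Hs s). exact Hb.
Qed.

(** Integrals are taken along horizontal and vertical lines only, so affine
    parametrizations are the only curves needed. *)
Lemma continuous_on_line (f : C -> C) (g : R -> C) (v : C) (t : R) :
  (forall s, g s - g t = RtoC (s - t) * v)%C -> ccont f (g t) ->
  @continuous R_UniformSpace C_R_CompleteNormedModule (fun s => f (g s)) t.
Proof.
  intros Hg H. apply continuous_RC. intros e He. destruct (H e He) as [d [Hd Hw]].
  pose proof (Cmod_ge_0 v) as Hv.
  assert (Hd' : 0 < d / (Cmod v + 1)) by (apply Rdiv_lt_0_compat; lra).
  exists (d / (Cmod v + 1)). split; [exact Hd'|]. intros s Hs. apply Hw.
  rewrite Hg, Cmod_mult, Cmod_R.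
  apply Rle_lt_trans with (Rabs (s - t) * (Cmod v + 1)).
  - apply Rmult_le_compat_l; [apply Rabs_pos|lra].
  - apply (Rmult_lt_compat_r (Cmod v + 1)) in Hs; [|lra].
    unfold Rdiv in Hs. rewrite Rmult_assoc, Rinv_l in Hs by lra. lra.
Qed.

Lemma is_derive_on_line (f : C -> C) (g : R -> C) (v d : C) (t : R) :
  (forall s, g s - g t = RtoC (s - t) * v)%C -> cder f (g t) d ->
  @is_derive R_AbsRing C_R_CompleteNormedModule (fun s => f (g s)) t (d * v)%C.
Proof.
  intros Hg H. split.
  - apply @is_linear_scal_l.
  - intros x Hx. apply (@is_filter_lim_locally_unique R_AbsRing R_NormedModule) in Hx.
    subst x. intros eps.
    pose proof (Cmod_ge_0 v) as Hv.
    assert (He : 0 < eps / (Cmod v + 1)) by (apply Rdiv_lt_0_compat; [apply cond_pos|lra]).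
    destruct (H _ He) as [dl [Hd Hw]].
    assert (Hd' : 0 < dl / (Cmod v + 1)) by (apply Rdiv_lt_0_compat; lra).
    exists (mkposreal _ Hd'). intros s Hs.
    change (Rabs (s - t) < dl / (Cmod v + 1)) in Hs.
    change (@norm R_AbsRing C_R_NormedModule
       (f (g s) - f (g t) - @scal R_AbsRing C_R_NormedModule (s - t)%R (d * v))%C
       <= eps * Rabs (s - t)).
    rewrite <- Cmod_norm.
    assert (E : @scal R_AbsRing C_R_NormedModule (s - t) (d * v)%C
                = (d * (g s - g t))%C).
    { rewrite Hg. apply injective_projections; simpl; unfold scal; simpl;
       unfold mult; simpl; ring. }
    rewrite E.
    eapply Rle_trans.
    + apply Hw. rewrite Hg, Cmod_mult, Cmod_R.
      apply Rle_lt_trans with (Rabs (s - t) * (Cmod v + 1)).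
      * apply Rmult_le_compat_l; [apply Rabs_pos|lra].
      * apply (Rmult_lt_compat_r (Cmod v + 1)) in Hs; [|lra].
        unfold Rdiv in Hs. rewrite Rmult_assoc, Rinv_l in Hs by lra. lra.
    + rewrite Hg, Cmod_mult, Cmod_R.
      replace (pos eps * Rabs (s - t))
        with (eps / (Cmod v + 1) * (Rabs (s - t) * (Cmod v + 1))) by (field; lra).
      apply Rmult_le_compat_l; [lra|].
      apply Rmult_le_compat_l; [apply Rabs_pos|lra].
Qed.

Notation RIntC := (@RInt C_R_CompleteNormedModule).
Notation ex_RIntC := (@ex_RInt C_R_NormedModule).
Notation is_RIntC := (@is_RInt C_R_NormedModule).
Notation contC := (@continuous R_UniformSpace C_R_CompleteNormedModule).

Lemma RIntC_correct (u : R -> C) a b :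
  ex_RIntC u a b -> is_RIntC u a b (RIntC u a b).
Proof. apply (@RInt_correct C_R_CompleteNormedModule). Qed.

Lemma ex_RIntC_cont (u : R -> C) a b :
  (forall t, Rmin a b <= t <= Rmax a b -> contC u t) -> ex_RIntC u a b.
Proof. apply (@ex_RInt_continuous C_R_CompleteNormedModule). Qed.

(** The form in which integrals are estimated everywhere below: an integrand
    close to a function with a known primitive. It combines the fundamental
    theorem of calculus with the norm inequality, and spares any use of
    complex linearity of the integral. *)
Lemma RIntC_close_le (u A A' : R -> C) (a b M : R) :
  a <= b ->
  (forall t, a <= t <= b -> contC u t) ->
  (forall t, a <= t <= b -> @is_derive R_AbsRing C_R_CompleteNormedModule A t (A' t)) ->
  (forall t, a <= t <= b -> contC A' t) ->
  (forall t, a <= t <= b -> Cmod (u t - A' t) <= M) ->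
  Cmod (RIntC u a b - (A b - A a)) <= (b - a) * M.
Proof.
  intros Hab Hu HA HA' HM.
  assert (Hmm : forall t, Rmin a b <= t <= Rmax a b -> a <= t <= b).
  { intros t. rewrite Rmin_left, Rmax_right by lra. auto. }
  rewrite Cmod_norm.
  apply (@norm_RInt_le_const C_R_NormedModule (fun t => u t - A' t)%C a b); [exact Hab| |].
  - intros x Hx. rewrite <- Cmod_norm. apply HM, Hx.
  - apply (@is_RInt_minus C_R_NormedModule).
    + apply RIntC_correct, ex_RIntC_cont. auto.
    + apply (@is_RInt_derive C_R_CompleteNormedModule); auto.
Qed.

Lemma RIntC_close (u A A' : R -> C) (a b M : R) :
  (forall t, Rmin a b <= t <= Rmax a b -> contC u t) ->
  (forall t, Rmin a b <= t <= Rmax a b ->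
     @is_derive R_AbsRing C_R_CompleteNormedModule A t (A' t)) ->
  (forall t, Rmin a b <= t <= Rmax a b -> contC A' t) ->
  (forall t, Rmin a b <= t <= Rmax a b -> Cmod (u t - A' t) <= M) ->
  Cmod (RIntC u a b - (A b - A a)) <= Rabs (b - a) * M.
Proof.
  intros Hu HA HA' HM. destruct (Rle_dec a b) as [H|H].
  - rewrite Rmin_left, Rmax_right in * by lra. rewrite Rabs_pos_eq by lra.
    apply RIntC_close_le with A'; assumption.
  - assert (E : RIntC u a b = (- RIntC u b a)%C).
    { symmetry. apply (@opp_RInt_swap C_R_CompleteNormedModule).
      apply ex_RIntC_cont. rewrite Rmin_comm, Rmax_comm. exact Hu. }
    rewrite E. rewrite Rmin_right, Rmax_left in * by lra.
    rewrite Rabs_minus_sym, (Rabs_pos_eq (a - b)) by lra. 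
    replace (- RIntC u b a - (A b - A a))%C with (- (RIntC u b a - (A a - A b)))%C by ring.
    rewrite Cmod_opp. apply RIntC_close_le with A'; try assumption. lra.
Qed.

Lemma RIntC_Chasles (u : R -> C) a b c :
  ex_RIntC u a b -> ex_RIntC u b c ->
  RIntC u a c = (RIntC u a b + RIntC u b c)%C.
Proof. intros H1 H2. symmetry. apply (@RInt_Chasles C_R_CompleteNormedModule); assumption. Qed.

(** Projecting the increment on its own direction reduces this to the real mean
    value theorem without loss in the constant. *)
Lemma mean_value_ineq (f f' : C -> C) (z w : C) (M : R) :
  (forall t, 0 <= t <= 1 -> cder f (z + RtoC t * (w - z)) (f' (z + RtoC t * (w - z)))%C) ->
  (forall t, 0 <= t <= 1 -> Cmod (f' (z + RtoC t * (w - z))%C) <= M) ->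
  Cmod (f w - f z) <= M * Cmod (w - z).
Proof.
  intros Hd HM.
  set (g := fun t : R => (z + RtoC t * (w - z))%C).
  set (v := (f w - f z)%C).
  set (u := fun t : R => Re (Cconj v * f (g t))%C).
  assert (Hu : forall t, 0 <= t <= 1 ->
     is_derive u t (Re (Cconj v * (f' (g t) * (w - z)))%C)).
  { intros t Ht.
    assert (H := is_derive_on_line (fun y => Cconj v * f y)%C g (w - z)%C
       (0 * f (g t) + Cconj v * f' (g t))%C t).
    assert (H1 : @is_derive R_AbsRing C_R_CompleteNormedModule
       (fun s => Cconj v * f (g s))%C t
       ((0 * f (g t) + Cconj v * f' (g t)) * (w - z))%C).
    { apply H.
      - intros s. unfold g. rewrite RtoC_minus. ring.
      - apply (cder_mult (fun _ => Cconj v) f); [apply cder_const|apply Hd, Ht]. }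
    replace (Cconj v * (f' (g t) * (w - z)))%C with
      ((0 * f (g t) + Cconj v * f' (g t)) * (w - z))%C by ring.
    unfold is_derive in *.
    refine (filterdiff_ext_lin _ _ _ (filterdiff_comp' 
       (U := R_NormedModule) (V := C_R_NormedModule) (W := R_NormedModule)
       _ (@fst R R) t _ (@fst R R) H1 _) _).
    - apply filterdiff_linear. apply is_linear_fst.
    - intros y. reflexivity. }
  destruct (MVT_gen u 0 1 (fun t => Re (Cconj v * (f' (g t) * (w - z)))%C)) as [c [Hc Hv]].
  { rewrite Rmin_left, Rmax_right by lra. intros t Ht. apply Hu. lra. }
  { rewrite Rmin_left, Rmax_right by lra. intros t Ht.
    apply continuity_pt_filterlim. apply (ex_derive_continuous u).
    eexists. apply Hu, Ht. }
  rewrite Rmin_left, Rmax_right in Hc by lra.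
  assert (E : u 1 - u 0 = Cmod v ^ 2).
  { unfold u, g. replace (z + 1 * (w - z))%C with w by ring.
    replace (z + 0 * (w - z))%C with z by ring.
    replace (Re (Cconj v * f w) - Re (Cconj v * f z)) with (Re (v * Cconj v)%C).
    - rewrite <- Cmod2_conj. reflexivity.
    - unfold v. destruct (f w), (f z). simpl. ring. }
  rewrite Rminus_0_r, Rmult_1_r in Hv. rewrite E in Hv.
  assert (B : Cmod v ^ 2 <= Cmod v * (M * Cmod (w - z))).
  { rewrite Hv. eapply Rle_trans; [apply Rle_abs|].
    eapply Rle_trans; [apply re_le_Cmod|].
    rewrite !Cmod_mult, Cmod_conj. apply Rmult_le_compat_l; [apply Cmod_ge_0|].
    apply Rmult_le_compat_r; [apply Cmod_ge_0|]. apply HM, Hc. }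
  destruct (Req_dec (Cmod v) 0) as [H0|H0].
  - fold v. rewrite H0. apply Rmult_le_pos; [|apply Cmod_ge_0].
    eapply Rle_trans; [apply Cmod_ge_0|apply (HM 0); lra].
  - fold v. pose proof (Cmod_ge_0 v). apply (Rmult_le_reg_l (Cmod v)); [lra|]. lra.
Qed.

(** * Goursat's theorem *)

Definition hside (f : C -> C) (a b c : R) : C := RIntC (fun x => f (x, c)) a b.
(** The factor [Ci] is the velocity of the upward parametrization; with it,
    telescoping of primitives around a rectangle needs no further constant. *)
Definition vside (f : C -> C) (a c d : R) : C := RIntC (fun y => Ci * f (a, y))%C c d.
Definition boundary_integral (f : C -> C) (a b c d : R) : C :=
  (hside f a b c + vside f b c d - hside f a b d - vside f a c d)%C.

Definition differentiable_on_rect (f : C -> C) (a b c d : R) : Prop :=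
  forall x y, a <= x <= b -> c <= y <= d -> exists e, cder f (x, y) e.

Lemma hline (c t : R) : forall s, (((s, c) : C) - (t, c) = RtoC (s - t) * 1)%C.
Proof. intros s. apply injective_projections; simpl; ring. Qed.

Lemma vline (a t : R) : forall s, (((a, s) : C) - (a, t) = RtoC (s - t) * Ci)%C.
Proof. intros s. apply injective_projections; simpl; ring. Qed.

Lemma hside_cont f c t : ccont f (t, c) -> contC (fun x => f (x, c)) t.
Proof.
  intros H. apply (continuous_on_line f (fun x => (x, c)) 1%C); [apply hline|exact H].
Qed.

Lemma ccont_scal (k : C) f z : ccont f z -> ccont (fun w => k * f w)%C z.
Proof.
  intros H e He. pose proof (Cmod_ge_0 k) as Hk.
  assert (He' : 0 < e / (Cmod k + 1)) by (apply Rdiv_lt_0_compat; lra).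
  destruct (H _ He') as [d [Hd Hw]]. exists d. split; [exact Hd|].
  intros w Hlt. specialize (Hw w Hlt).
  replace (k * f w - k * f z)%C with (k * (f w - f z))%C by ring. rewrite Cmod_mult.
  apply Rle_lt_trans with (Cmod (f w - f z) * (Cmod k + 1)).
  - pose proof (Cmod_ge_0 (f w - f z)). nra.
  - apply (Rmult_lt_compat_r (Cmod k + 1)) in Hw; [|lra].
    unfold Rdiv in Hw. rewrite Rmult_assoc, Rinv_l in Hw by lra. lra.
Qed.

Lemma vside_cont f a t : ccont f (a, t) -> contC (fun y => Ci * f (a, y))%C t.
Proof.
  intros H. apply (continuous_on_line (fun w => Ci * f w)%C (fun y => (a, y)) Ci);
   [apply vline|apply ccont_scal, H].
Qed.

Lemma hside_Chasles f a b m c :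
  (forall x, Rmin (Rmin a b) m <= x <= Rmax (Rmax a b) m -> ccont f (x, c)) ->
  hside f a b c = (hside f a m c + hside f m b c)%C.
Proof.
  intros H. apply RIntC_Chasles; apply ex_RIntC_cont; intros t Ht;
   apply hside_cont, H; revert Ht; unfold Rmin, Rmax;
   repeat (destruct Rle_dec); lra.
Qed.

Lemma vside_Chasles f a c d m :
  (forall y, Rmin (Rmin c d) m <= y <= Rmax (Rmax c d) m -> ccont f (a, y)) ->
  vside f a c d = (vside f a c m + vside f a m d)%C.
Proof.
  intros H. apply RIntC_Chasles; apply ex_RIntC_cont; intros t Ht;
   apply vside_cont, H; revert Ht; unfold Rmin, Rmax;
   repeat (destruct Rle_dec); lra.
Qed.

Lemma hside_close (f P P' : C -> C) (a b c M : R) :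
  (forall x, Rmin a b <= x <= Rmax a b -> ccont f (x, c)) ->
  (forall x, Rmin a b <= x <= Rmax a b -> cder P (x, c) (P' (x, c))) ->
  (forall x, Rmin a b <= x <= Rmax a b -> ccont P' (x, c)) ->
  (forall x, Rmin a b <= x <= Rmax a b -> Cmod (f (x, c) - P' (x, c)) <= M) ->
  Cmod (hside f a b c - (P (b, c) - P (a, c))) <= Rabs (b - a) * M.
Proof.
  intros H1 H2 H3 H4.
  apply (RIntC_close (fun x => f (x, c)) (fun x => P (x, c)) (fun x => P' (x, c))).
  - intros t Ht. apply hside_cont, H1, Ht.
  - intros t Ht. replace (P' (t, c)) with (P' (t, c) * 1)%C by ring.
    apply (is_derive_on_line P (fun x => (x, c))); [apply hline|apply H2, Ht].
  - intros t Ht. apply hside_cont, H3, Ht.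
  - exact H4.
Qed.

Lemma vside_close (f P P' : C -> C) (a c d M : R) :
  (forall y, Rmin c d <= y <= Rmax c d -> ccont f (a, y)) ->
  (forall y, Rmin c d <= y <= Rmax c d -> cder P (a, y) (P' (a, y))) ->
  (forall y, Rmin c d <= y <= Rmax c d -> ccont P' (a, y)) ->
  (forall y, Rmin c d <= y <= Rmax c d -> Cmod (f (a, y) - P' (a, y)) <= M) ->
  Cmod (vside f a c d - (P (a, d) - P (a, c))) <= Rabs (d - c) * M.
Proof.
  intros H1 H2 H3 H4.
  apply (RIntC_close (fun y => Ci * f (a, y))%C (fun y => P (a, y)) (fun y => Ci * P' (a, y))%C).
  - intros t Ht. apply vside_cont, H1, Ht.
  - intros t Ht. replace (Ci * P' (a, t))%C with (P' (a, t) * Ci)%C by ring.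
    apply (is_derive_on_line P (fun y => (a, y))); [apply vline|apply H2, Ht].
  - intros t Ht. apply vside_cont, H3, Ht.
  - intros t Ht. replace (Ci * f (a, t) - Ci * P' (a, t))%C with
     (Ci * (f (a, t) - P' (a, t)))%C by ring.
    rewrite Cmod_mult, Cmod_Ci, Rmult_1_l. apply H4, Ht.
Qed.

Lemma diff_rect_sub f a b c d a' b' c' d' :
  a <= a' -> b' <= b -> c <= c' -> d' <= d ->
  differentiable_on_rect f a b c d -> differentiable_on_rect f a' b' c' d'.
Proof. intros ? ? ? ? H x y Hx Hy. apply H; lra. Qed.

Lemma diff_rect_cont f a b c d x y :
  differentiable_on_rect f a b c d -> a <= x <= b -> c <= y <= d -> ccont f (x, y).
Proof. intros H Hx Hy. destruct (H x y Hx Hy) as [e He]. exact (cder_cont _ _ _ He). Qed.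

Lemma boundary_integral_split_x f a b c d m :
  a <= m <= b -> c <= d -> differentiable_on_rect f a b c d ->
  boundary_integral f a b c d =
  (boundary_integral f a m c d + boundary_integral f m b c d)%C.
Proof.
  intros Hm Hcd H. unfold boundary_integral.
  rewrite (hside_Chasles f a b m c), (hside_Chasles f a b m d).
  - ring.
  - intros x Hx. apply (diff_rect_cont f a b c d); [exact H| |lra].
    revert Hx. unfold Rmin, Rmax; repeat (destruct Rle_dec); lra.
  - intros x Hx. apply (diff_rect_cont f a b c d); [exact H| |lra].
    revert Hx. unfold Rmin, Rmax; repeat (destruct Rle_dec); lra.
Qed.

Lemma boundary_integral_split_y f a b c d m :
  a <= b -> c <= m <= d -> differentiable_on_rect f a b c d ->
  boundary_integral f a b c d =
  (boundary_integral f a b c m + boundary_integral f a b m d)%C.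
Proof.
  intros Hab Hm H. unfold boundary_integral.
  rewrite (vside_Chasles f a c d m), (vside_Chasles f b c d m).
  - ring.
  - intros x Hx. apply (diff_rect_cont f a b c d); [exact H|lra|].
    revert Hx. unfold Rmin, Rmax; repeat (destruct Rle_dec); lra.
  - intros x Hx. apply (diff_rect_cont f a b c d); [exact H|lra|].
    revert Hx. unfold Rmin, Rmax; repeat (destruct Rle_dec); lra.
Qed.

(** A quadratic polynomial with derivative the affine approximation of [f] at
    [p] telescopes to 0 around the rectangle, so only the error of that
    approximation contributes. *)
Lemma boundary_integral_local f a b c d (p e : C) (eps : R) :
  a <= b -> c <= d -> 0 <= eps ->
  differentiable_on_rect f a b c d ->
  a <= Re p <= b -> c <= Im p <= d ->
  (forall x y, a <= x <= b -> c <= y <= d ->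
     Cmod (f (x, y) - f p - e * ((x, y) - p)) <= eps * Cmod ((x, y) - p)) ->
  Cmod (boundary_integral f a b c d) <= 2 * eps * ((b - a) + (d - c)) ^ 2.
Proof.
  intros Hab Hcd Heps H Hp1 Hp2 Hloc.
  set (P := fun z => (f p * z + e / 2 * ((z - p) * (z - p)))%C).
  set (P' := fun z => (f p + e * (z - p))%C).
  assert (DP : forall z, cder P z (P' z)).
  { intros z. unfold P, P'. eapply cder_eq.
    - apply (cder_plus (fun z => f p * z)%C (fun z => e / 2 * ((z - p) * (z - p)))%C).
      + apply (cder_mult (fun _ => f p) (fun z => z)); [apply cder_const|apply cder_id].
      + apply (cder_mult (fun _ => e / 2)%C (fun z => (z - p) * (z - p))%C);
          [apply cder_const|].
        apply (cder_mult (fun z => z - p)%C (fun z => z - p)%C);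
         apply cder_minus; try apply cder_id; apply cder_const.
    - simpl. field. }
  assert (CP : forall z, ccont P' z).
  { intros z. eapply (cder_cont P' z (0 + (0 * (z - p) + e * (1 - 0)))%C).
    apply (cder_plus (fun _ => f p) (fun z => e * (z - p))%C); [apply cder_const|].
    apply (cder_mult (fun _ => e) (fun z => z - p)%C); [apply cder_const|].
    apply cder_minus; [apply cder_id|apply cder_const]. }
  set (s := (b - a) + (d - c)).
  assert (B : forall x y, a <= x <= b -> c <= y <= d ->
     Cmod (f (x, y) - P' (x, y)) <= eps * s).
  { intros x y Hx Hy. unfold P'.
    replace (f (x, y) - (f p + e * ((x, y) - p)))%C
      with (f (x, y) - f p - e * ((x, y) - p))%C by ring.
    eapply Rle_trans; [apply Hloc; assumption|].
    apply Rmult_le_compat_l; [exact Heps|].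
    eapply Rle_trans; [apply Cmod_le_Rabs|].
    destruct p as [p1 p2]. simpl in *. unfold s.
    apply Rplus_le_compat; apply Rabs_le; lra. }
  assert (Cf : forall x y, a <= x <= b -> c <= y <= d -> ccont f (x, y)).
  { intros x y. apply diff_rect_cont. exact H. }
  assert (Sh : forall y, c <= y <= d ->
     Cmod (hside f a b y - (P (b, y) - P (a, y))) <= (b - a) * (eps * s)).
  { intros y Hy. rewrite <- (Rabs_pos_eq (b - a)) by lra.
    apply (hside_close f P P'); intros x; rewrite Rmin_left, Rmax_right by lra; auto. }
  assert (Sv : forall x, a <= x <= b ->
     Cmod (vside f x c d - (P (x, d) - P (x, c))) <= (d - c) * (eps * s)).
  { intros x Hx. rewrite <- (Rabs_pos_eq (d - c)) by lra.
    apply (vside_close f P P'); intros y; rewrite Rmin_left, Rmax_right by lra; auto. }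
  unfold boundary_integral.
  replace (hside f a b c + vside f b c d - hside f a b d - vside f a c d)%C with
   ((hside f a b c - (P (b, c) - P (a, c))) + (vside f b c d - (P (b, d) - P (b, c)))
    + (- (hside f a b d - (P (b, d) - P (a, d)))) + (- (vside f a c d - (P (a, d) - P (a, c)))))%C
   by ring.
  pose proof (Sh c ltac:(lra)). pose proof (Sh d ltac:(lra)).
  pose proof (Sv a ltac:(lra)). pose proof (Sv b ltac:(lra)).
  eapply Rle_trans; [apply Cmod_triangle|].
  eapply Rle_trans; [apply Rplus_le_compat_r, Cmod_triangle|].
  eapply Rle_trans; [apply Rplus_le_compat_r, Rplus_le_compat_r, Cmod_triangle|].
  rewrite !Cmod_opp. unfold s in *. nra.
Qed.

Lemma nested_intervals (u l : nat -> R) :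
  (forall n, 0 <= l n) -> (forall n, u n <= u (S n)) ->
  (forall n, u (S n) + l (S n) <= u n + l n) ->
  exists x, forall n, u n <= x <= u n + l n.
Proof.
  intros Hl Hu Hd.
  assert (I : forall m k, u m <= u (m + k)%nat).
  { intros m k. induction k as [|k IH]; [rewrite Nat.add_0_r; lra|].
    rewrite Nat.add_succ_r. specialize (Hu (m + k)%nat). lra. }
  assert (D : forall m k, u (m + k)%nat + l (m + k)%nat <= u m + l m).
  { intros m k. induction k as [|k IH]; [rewrite Nat.add_0_r; lra|].
    rewrite Nat.add_succ_r. specialize (Hd (m + k)%nat). lra. }
  assert (X : forall n m, u n <= u m + l m).
  { intros n m. destruct (Nat.le_ge_cases n m) as [H|H].
    - replace m with (n + (m - n))%nat by lia.
      specialize (I n (m - n)%nat). specialize (Hl (n + (m - n))%nat). lra.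
    - specialize (D m (n - m)%nat). replace (m + (n - m))%nat with n in D by lia.
      specialize (Hl n). lra. }
  destruct (completeness (fun x => exists n, x = u n)) as [x [Hx1 Hx2]].
  - exists (u O + l O). intros y [n ->]. apply X.
  - exists (u O). exists O. reflexivity.
  - exists x. intros n. split.
    + apply Hx1. exists n. reflexivity.
    + apply Hx2. intros y [m ->]. apply X.
Qed.

Lemma Cmod_four (z1 z2 z3 z4 : C) (s : R) :
  Cmod z1 < s -> Cmod z2 < s -> Cmod z3 < s -> Cmod z4 < s ->
  Cmod (z1 + z2 + (z3 + z4)) < 4 * s.
Proof.
  intros. pose proof (Cmod_triangle (z1 + z2) (z3 + z4)).
  pose proof (Cmod_triangle z1 z2). pose proof (Cmod_triangle z3 z4). lra.
Qed.

(** Goursat's bisection: were the integral non-zero, one of the four quarters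
    would carry at least a quarter of it, and so on; the quarters shrink to a
    point [p], where differentiability bounds the integral by an arbitrarily
    small multiple of the squared half-perimeter, which also shrinks by four at
    each step. *)
Theorem Goursat f a b c d :
  a <= b -> c <= d -> differentiable_on_rect f a b c d ->
  boundary_integral f a b c d = 0%C.
Proof.
  intros Hab Hcd H.
  set (l := fun n => (b - a) / 2 ^ n). set (h := fun n => (d - c) / 2 ^ n).
  assert (Hl : forall n, 0 <= l n).
  { intros n. apply Rle_div_r; [apply pow_lt; lra|]. lra. }
  assert (Hh : forall n, 0 <= h n).
  { intros n. apply Rle_div_r; [apply pow_lt; lra|]. lra. }
  assert (P2 : forall n, 2 ^ n <> 0) by (intros n; apply pow_nonzero; lra).
  assert (Hl2 : forall n, l n = 2 * l (S n)).
  { intros n. unfold l. simpl. field. apply P2. }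
  assert (Hh2 : forall n, h n = 2 * h (S n)).
  { intros n. unfold h. simpl. field. apply P2. }
  set (Q := fun n (p : R * R) =>
    boundary_integral f (fst p) (fst p + l n) (snd p) (snd p + h n)).
  set (inv := fun n (p : R * R) =>
    a <= fst p /\ fst p + l n <= b /\ c <= snd p /\ snd p + h n <= d).
  set (G := fun n (p p' : R * R) =>
    fst p <= fst p' /\ fst p' + l (S n) <= fst p + l n /\
    snd p <= snd p' /\ snd p' + h (S n) <= snd p + h n /\
    Cmod (Q n p) <= 4 * Cmod (Q (S n) p')).
  assert (step : forall n p, inv n p -> exists p', G n p p').
  { intros n [x y] Hi. apply NNPP. intros Hno.
    assert (E : Q n (x, y) = (Q (S n) (x, y) + Q (S n) (x, y + h (S n))%R
       + (Q (S n) (x + l (S n), y)%R + Q (S n) (x + l (S n), y + h (S n))%R))%C).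
    { unfold inv in Hi. unfold Q. simpl in *.
      pose proof (Hl (S n)). pose proof (Hh (S n)). rewrite (Hl2 n), (Hh2 n) in *.
      assert (HD : differentiable_on_rect f x (x + 2 * l (S n)) y (y + 2 * h (S n)))
        by (apply (diff_rect_sub f a b c d); try lra; exact H).
      rewrite (boundary_integral_split_x f x _ y _ (x + l (S n)));
        [|lra|lra|exact HD].
      rewrite (boundary_integral_split_y f x (x + l (S n)) y _ (y + h (S n)));
        [|lra|lra|eapply diff_rect_sub; [..|exact HD]; lra].
      rewrite (boundary_integral_split_y f (x + l (S n)) _ y _ (y + h (S n)));
        [|lra|lra|eapply diff_rect_sub; [..|exact HD]; lra].
      replace (y + h (S n) + h (S n)) with (y + 2 * h (S n)) by ring.
      replace (x + l (S n) + l (S n)) with (x + 2 * l (S n)) by ring.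
      reflexivity. }
    assert (W : forall p', G n (x, y) p' \/ Cmod (Q (S n) p') < Cmod (Q n (x, y)) / 4 \/
      ~ (x <= fst p' /\ fst p' + l (S n) <= x + l n /\ y <= snd p' /\ snd p' + h (S n) <= y + h n)).
    { intros p'. unfold G; simpl fst; simpl snd.
      destruct (Rlt_dec (Cmod (Q (S n) p')) (Cmod (Q n (x, y)) / 4)) as [|K]; [tauto|].
      assert (Cmod (Q n (x, y)) <= 4 * Cmod (Q (S n) p')) by lra. tauto. }
    assert (Y : forall p', x <= fst p' /\ fst p' + l (S n) <= x + l n /\
       y <= snd p' /\ snd p' + h (S n) <= y + h n -> Cmod (Q (S n) p') < Cmod (Q n (x, y)) / 4).
    { intros p' Hp'. destruct (W p') as [K|[K|K]]; [|exact K|contradiction].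
      exfalso. apply Hno. exists p'. exact K. }
    pose proof (Hl (S n)). pose proof (Hh (S n)). pose proof (Hl2 n). pose proof (Hh2 n).
    assert (Z := Cmod_four _ _ _ _ _ (Y (x, y) ltac:(simpl; lra))
      (Y (x, y + h (S n))%R ltac:(simpl; lra))
      (Y (x + l (S n), y)%R ltac:(simpl; lra))
      (Y (x + l (S n), y + h (S n))%R ltac:(simpl; lra))).
    rewrite <- E in Z. lra. }
  set (nxt := fun n p => epsilon (inhabits (0, 0)) (G n p)).
  set (s := fix s n := match n with O => (a, c) | S n => nxt n (s n) end).
  assert (Sinv : forall n, inv n (s n)).
  { induction n as [|n IH].
    - unfold inv, l, h; simpl. lra.
    - assert (K := epsilon_spec (inhabits (0, 0)) (G n (s n)) (step n _ IH)).
      fold (nxt n (s n)) in K. change (nxt n (s n)) with (s (S n)) in K.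
      unfold G in K. unfold inv in *. lra. }
  assert (SG : forall n, G n (s n) (s (S n))).
  { intros n. exact (epsilon_spec (inhabits (0, 0)) (G n (s n)) (step n _ (Sinv n))). }
  assert (SQ : forall n, Cmod (Q O (s O)) <= 4 ^ n * Cmod (Q n (s n))).
  { induction n as [|n IH]; [simpl; lra|].
    destruct (SG n) as (_ & _ & _ & _ & K). simpl pow.
    assert (0 < 4 ^ n) by (apply pow_lt; lra). nra. }
  destruct (nested_intervals (fun n => fst (s n)) l Hl) as [px Hpx].
  { intros n. apply (SG n). } { intros n. apply (SG n). }
  destruct (nested_intervals (fun n => snd (s n)) h Hh) as [py Hpy].
  { intros n. apply (SG n). } { intros n. apply (SG n). }
  destruct (H px py) as [e He].
  { specialize (Hpx O). destruct (Sinv O) as (I1 & I2 & _). lra. }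
  { specialize (Hpy O). destruct (Sinv O) as (_ & _ & I1 & I2). lra. }
  assert (E0 : Q O (s O) = boundary_integral f a b c d).
  { unfold Q, l, h. simpl. f_equal; field. }
  rewrite E0 in SQ.
  set (S0 := (b - a) + (d - c)).
  apply Cmod_eq_0. apply Rle_antisym; [|apply Cmod_ge_0].
  apply Rnot_lt_le. intros Hpos.
  set (m := Cmod (boundary_integral f a b c d)) in *.
  assert (HS : 0 <= S0) by (unfold S0; lra).
  set (eps := m / (4 * (S0 + 1) ^ 2)).
  assert (Hsq : 0 < (S0 + 1) ^ 2) by (apply pow_lt; lra).
  assert (Heps : 0 < eps) by (apply Rdiv_lt_0_compat; lra).
  destruct (He eps Heps) as [dl [Hdl Hw]].
  (* the rectangle at level n has half-perimeter S0 / 2 ^ n *)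
  assert (Hn : exists n, S0 / 2 ^ n < dl).
  { destruct (pow_lt_1_zero (/ 2) ltac:(rewrite Rabs_pos_eq; lra) (dl / (S0 + 1))) as [n Hn].
    - apply Rdiv_lt_0_compat; lra.
    - exists n. specialize (Hn n (Nat.le_refl n)).
      rewrite Rabs_pos_eq in Hn by (apply pow_le; lra). rewrite pow_inv in Hn.
      apply (Rmult_lt_compat_r (S0 + 1)) in Hn; [|lra].
      unfold Rdiv in Hn. rewrite (Rmult_assoc dl), Rinv_l in Hn by lra.
      assert (0 < / 2 ^ n) by (apply Rinv_0_lt_compat, pow_lt; lra). unfold Rdiv. nra. }
  destruct Hn as [n Hn].
  assert (Es : l n + h n = S0 / 2 ^ n) by (unfold l, h, S0; field; apply P2).
  assert (B : Cmod (Q n (s n)) <= 2 * eps * (S0 / 2 ^ n) ^ 2).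
  { rewrite <- Es. specialize (Sinv n). unfold inv in Sinv.
    specialize (Hpx n). specialize (Hpy n). specialize (Hl n). specialize (Hh n).
    unfold Q. set (x := fst (s n)) in *. set (y := snd (s n)) in *.
    replace (l n + h n) with ((x + l n - x) + (y + h n - y)) by ring.
    apply (boundary_integral_local f x (x + l n) y (y + h n) (px, py) e); simpl; try lra.
    - apply (diff_rect_sub f a b c d); try lra. exact H.
    - intros x' y' Hx' Hy'. apply Hw.
      eapply Rle_lt_trans; [apply Cmod_le_Rabs|].
      eapply Rle_lt_trans; [|exact Hn]. rewrite <- Es. simpl.
      apply Rplus_le_compat; apply Rabs_le; lra. }
  specialize (SQ n).
  assert (F : 4 ^ n * (S0 / 2 ^ n) ^ 2 = S0 ^ 2).
  { replace 4 with (2 * 2) by ring. rewrite Rpow_mult_distr. field. apply P2. }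
  assert (0 < 4 ^ n) by (apply pow_lt; lra).
  assert (m <= 2 * eps * S0 ^ 2) by (rewrite <- F; nra).
  assert (2 * eps * S0 ^ 2 <= 2 * eps * (S0 + 1) ^ 2).
  { apply Rmult_le_compat_l; [lra|]. apply pow_incr; lra. }
  assert (2 * eps * (S0 + 1) ^ 2 = m / 2) by (unfold eps; field; lra).
  lra.
Qed.

(** * Maximum principle and Cauchy estimate *)

Definition differentiable_on_disc (f : C -> C) (a : C) (rad : R) : Prop :=
  forall z, Cmod (z - a) < rad -> exists e, cder f z e.

(** The maximum principle at a removable point. In the coordinate w with
    z = a + e^w, circles become vertical segments of height 2 pi; on a
    rectangle of that height the two horizontal sides cancel by periodicity, so
    Goursat's theorem says that the mean over a circle does not depend on its
    radius. Small circles give [d], the circle of radius [r] gives the bound. *)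
Lemma circle_bound_limit (q : C -> C) (a d : C) (rad r M : R) :
  0 < r < rad ->
  (forall z, 0 < Cmod (z - a) < rad -> exists e, cder q z e) ->
  (forall eps, 0 < eps -> exists delta, 0 < delta /\
     forall z, 0 < Cmod (z - a) < delta -> Cmod (q z - d) <= eps) ->
  (forall z, Cmod (z - a) = r -> Cmod (q z) <= M) ->
  Cmod d <= M.
Proof.
  intros Hr Hq Hd HM. apply le_epsilon. intros eps Heps.
  destruct (Hd eps Heps) as [dl [Hdl Hw]].
  set (G := fun w => q (a + Cexp w)%C).
  assert (Hmod : forall x y, Cmod (a + Cexp (x, y) - a) = exp x).
  { intros x y. replace (a + Cexp (x, y) - a)%C with (Cexp (x, y)) by ring.
    apply Cmod_Cexp. }
  assert (HG : forall x y, x <= ln r -> exists e, cder G (x, y) e).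
  { intros x y Hx. destruct (Hq (a + Cexp (x, y))%C) as [e He].
    - rewrite Hmod. split; [apply exp_pos|].
      apply Rle_lt_trans with r; [|lra]. rewrite <- (exp_ln r) by lra.
      destruct Hx as [Hx| ->]; [left; apply exp_increasing, Hx|right; reflexivity].
    - eexists. apply (cder_comp q (fun w => a + Cexp w)%C); [exact He|].
      apply cder_plus; [apply cder_const|apply cder_Cexp]. }
  (* the abscissa of a circle inside the disc where q is close to d *)
  set (x0 := Rmin (ln r) (ln (dl / 2))).
  assert (Hx0 : x0 <= ln r) by apply Rmin_l.
  assert (Hx0' : exp x0 < dl).
  { apply Rle_lt_trans with (dl / 2); [|lra]. rewrite <- (exp_ln (dl / 2)) by lra.
    assert (K : x0 <= ln (dl / 2)) by apply Rmin_r.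
    destruct K as [K| ->]; [left; apply exp_increasing, K|right; reflexivity]. }
  pose proof PI_RGT_0 as HPI.
  assert (Gt := Goursat G x0 (ln r) 0 (2 * PI) Hx0 ltac:(lra)
     ltac:(intros x y Hx Hy; apply HG; lra)).
  unfold boundary_integral in Gt.
  assert (Eh : hside G x0 (ln r) 0 = hside G x0 (ln r) (2 * PI)).
  { unfold hside, G. apply (@RInt_ext C_R_CompleteNormedModule). intros x _. unfold Cexp. simpl.
    rewrite cos_0, sin_0, cos_2PI, sin_2PI. reflexivity. }
  rewrite Eh in Gt.
  assert (Ev : vside G (ln r) 0 (2 * PI) = vside G x0 0 (2 * PI)).
  { match type of Gt with (?u + ?v - ?u - ?w)%C = _ =>
      replace v with ((u + v - u - w) + w)%C by ring end. rewrite Gt. ring. }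
  assert (B1 : Cmod (vside G x0 0 (2 * PI) - (d * (x0, 2 * PI)%R - d * (x0, 0)%R))
    <= Rabs (2 * PI - 0) * eps).
  { apply (vside_close G (fun z => d * z)%C (fun _ => d)).
    - intros y _. destruct (HG x0 y Hx0) as [e He]. exact (cder_cont _ _ _ He).
    - intros y _. eapply cder_eq; [apply (cder_mult (fun _ => d) (fun z => z));
        [apply cder_const|apply cder_id]|]. simpl. ring.
    - intros y _. apply (cder_cont _ _ _ (cder_const d _)).
    - intros y _. apply Hw. rewrite Hmod. split; [apply exp_pos|exact Hx0']. }
  assert (B2 : Cmod (vside G (ln r) 0 (2 * PI) - (0 - 0)) <= Rabs (2 * PI - 0) * M).
  { apply (vside_close G (fun z => 0)%C (fun _ => 0%C)).
    - intros y _. destruct (HG (ln r) y ltac:(lra)) as [e He]. exact (cder_cont _ _ _ He).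
    - intros y _. apply cder_const.
    - intros y _. apply (cder_cont _ _ _ (cder_const 0 _)).
    - intros y _. replace (G (ln r, y) - 0)%C with (G (ln r, y)) by ring.
      apply HM. rewrite Hmod. apply exp_ln. lra. }
  rewrite Ev in B2. rewrite Rabs_pos_eq in B1, B2 by lra.
  set (v := vside G x0 0 (2 * PI)) in *.
  replace (v - (0 - 0))%C with v in B2 by ring.
  assert (E2 : Cmod (d * (x0, 2 * PI)%R - d * (x0, 0)%R) = Cmod d * (2 * PI)).
  { replace (d * (x0, 2 * PI)%R - d * (x0, 0)%R)%C with (d * (Ci * RtoC (2 * PI)))%C.
    - rewrite !Cmod_mult, Cmod_Ci, Cmod_R, Rabs_pos_eq by lra. ring.
    - apply injective_projections; simpl; ring. }
  assert (T := Cmod_le_add (d * (x0, 2 * PI)%R - d * (x0, 0)%R) v).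
  rewrite E2, Cmod_minus_sym in T. nra.
Qed.

Lemma max_principle (f : C -> C) (a : C) (rad r M : R) :
  0 < r < rad -> differentiable_on_disc f a rad ->
  (forall z, Cmod (z - a) = r -> Cmod (f z) <= M) ->
  Cmod (f a) <= M.
Proof.
  intros Hr Hf HM. apply (circle_bound_limit f a (f a) rad r M); try assumption.
  - intros z Hz. apply Hf. lra.
  - intros eps He. destruct (Hf a) as [e Hd].
    { replace (a - a)%C with (RtoC 0) by ring. rewrite Cmod_0. lra. }
    destruct (cder_cont _ _ _ Hd eps He) as [dl [Hdl Hw]].
    exists dl. split; [exact Hdl|]. intros z Hz. left. apply Hw. lra.
Qed.

Lemma Cminus_neq_0 (z a : C) : 0 < Cmod (z - a) -> (z - a)%C <> 0%C.
Proof. intros H. apply Cmod_gt_0. exact H. Qed.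

(** The maximum principle for the difference quotient of [f] at [a], whose limit
    there is the derivative. *)
Lemma cauchy_estimate (f : C -> C) (a e : C) (rad r M : R) :
  0 < r < rad -> differentiable_on_disc f a rad -> cder f a e ->
  (forall z, Cmod (z - a) = r -> Cmod (f z - f a) <= M) ->
  Cmod e <= M / r.
Proof.
  intros Hr Hf He HM.
  apply (circle_bound_limit (fun z => (f z - f a) / (z - a))%C a e rad r); [exact Hr| | |].
  - intros z Hz. destruct (Hf z) as [e' He']; [lra|]. eexists.
    apply (cder_div (fun z => f z - f a)%C (fun z => z - a)%C);
      [apply Cminus_neq_0; lra| |].
    + apply cder_minus; [exact He'|apply cder_const].
    + apply cder_minus; [apply cder_id|apply cder_const].
  - intros eps Heps. destruct (He eps Heps) as [dl [Hdl Hw]].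
    exists dl. split; [exact Hdl|]. intros z Hz.
    assert (N : (z - a)%C <> 0%C) by (apply Cminus_neq_0; lra).
    replace ((f z - f a) / (z - a) - e)%C with ((f z - f a - e * (z - a)) / (z - a))%C
      by (field; exact N).
    rewrite Cmod_div by exact N. apply Rle_div_l; [lra|]. apply Hw. lra.
  - intros z Hz. assert (N : (z - a)%C <> 0%C) by (apply Cminus_neq_0; lra).
    rewrite Cmod_div by exact N. rewrite Hz.
    apply Rmult_le_compat_r; [left; apply Rinv_0_lt_compat; lra|]. apply HM, Hz.
Qed.

Lemma disc_segment (a z w : C) (rad t : R) :
  0 <= t <= 1 -> Cmod (z - a) < rad -> Cmod (w - a) < rad ->
  Cmod (z + RtoC t * (w - z) - a) < rad.
Proof.
  intros Ht Hz Hw.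
  replace (z + RtoC t * (w - z) - a)%C with (RtoC (1 - t) * (z - a) + RtoC t * (w - a))%C
    by (rewrite RtoC_minus; ring).
  eapply Rle_lt_trans; [apply Cmod_triangle|]. rewrite !Cmod_mult, !Cmod_R.
  rewrite !Rabs_pos_eq by lra.
  destruct (Req_dec t 0) as [->|N]; [lra|].
  assert (t * Cmod (w - a) < t * rad) by (apply Rmult_lt_compat_l; lra).
  assert ((1 - t) * Cmod (z - a) <= (1 - t) * rad) by (apply Rmult_le_compat_l; lra).
  lra.
Qed.

Lemma cder_derive f z : (exists e, cder f z e) -> cder f z (C_derive f z).
Proof.
  intros [e He]. apply cder_C_derive, (C_derive_correct f z z).
  exists e. apply cder_C_derive, He.
Qed.

(** * Differentiability of the derivative *)

(** A Cauchy criterion with explicit rate: the estimate survives in the limit. *)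
Lemma punctured_limit (Q : C -> C) (rho K : R) :
  0 < rho -> 0 <= K ->
  (forall h k, 0 < Cmod h < rho -> 0 < Cmod k < rho ->
     Cmod (Q h - Q k) <= K * (Cmod h + Cmod k)) ->
  exists b, forall h, 0 < Cmod h < rho -> Cmod (Q h - b) <= K * Cmod h.
Proof.
  intros Hrho HK H.
  set (x := fun n : nat => RtoC (rho / (INR n + 2))).
  assert (Hn : forall n, 0 < INR n + 2) by (intros n; pose proof (pos_INR n); lra).
  assert (Hx : forall n, Cmod (x n) = rho / (INR n + 2)).
  { intros n. unfold x. rewrite Cmod_R, Rabs_pos_eq; [reflexivity|].
    left. apply Rdiv_lt_0_compat; auto. }
  assert (Hx1 : forall n, 0 < Cmod (x n) < rho).
  { intros n. rewrite Hx. split; [apply Rdiv_lt_0_compat; auto|].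
    apply Rlt_div_l; [apply Hn|]. pose proof (pos_INR n). nra. }
  assert (Hsmall : forall eps, 0 < eps -> exists N, forall n, (N <= n)%nat -> K * Cmod (x n) < eps).
  { intros eps He. destruct (nfloor_ex (K * rho / eps)) as [N [_ HN]].
    { apply Rle_div_r; [lra|]. nra. }
    exists N. intros n Hle. rewrite Hx. apply le_INR in Hle.
    unfold Rdiv. rewrite <- Rmult_assoc. apply Rlt_div_l; [apply Hn|].
    apply Rlt_div_l in HN; [|lra]. nra. }
  destruct (proj1 (@filterlim_locally_cauchy nat C_R_CompleteNormedModule eventually _
     (fun n => Q (x n)))) as [b Hb].
  - intros eps. destruct (Hsmall (eps / 2)) as [N HN]; [apply is_pos_div_2|].
    exists (fun n => (N <= n)%nat). split; [exists N; auto|].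
    intros n m Hn' Hm'. apply C_NormedModule_mixin_compat1.
    change (Cmod (Q (x m) - Q (x n)) < eps).
    eapply Rle_lt_trans; [apply H; apply Hx1|].
    pose proof (HN n Hn'). pose proof (HN m Hm'). lra.
  - exists b. intros h Hh. apply le_epsilon. intros eps He.
    destruct (Hsmall (eps / 2)) as [N HN]; [lra|].
    assert (He2 : 0 < eps / 2 / 2) by lra.
    assert (Hb' := proj1 (filterlim_locally _ _) Hb (mkposreal _ He2)).
    destruct Hb' as [N' HN'].
    set (n := Nat.max N N').
    specialize (HN n (Nat.le_max_l _ _)). specialize (HN' n (Nat.le_max_r _ _)).
    apply C_NormedModule_mixin_compat2 in HN'. 
    change (Cmod (Q (x n) - b) < sqrt 2 * (eps / 2 / 2)) in HN'.
    assert (sqrt 2 < 2).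
    { apply Rsqr_incrst_0; try lra; [|apply sqrt_pos]. rewrite Rsqr_sqrt; unfold Rsqr; lra. }
    specialize (H h (x n) Hh (Hx1 n)).
    replace (Q h - b)%C with ((Q h - Q (x n)) + (Q (x n) - b))%C by ring.
    eapply Rle_trans; [apply Cmod_triangle|]. nra.
Qed.

(** Two applications of the Cauchy estimate replace the integral formula for
    the derivative. Applied to f(w+h) - f(w) it shows that f' is Lipschitz,
    so that the difference quotients of [f] converge uniformly to f' with
    an error linear in h. Applied to the difference of the quotients for two
    increments h and k, it shows that the difference quotients of f' satisfy
    the Cauchy criterion. *)
Lemma derivative_differentiable_bounded (f f' : C -> C) (a : C) (rad M : R) :
  0 < rad -> (forall z, Cmod (z - a) < rad -> cder f z (f' z)) ->
  (forall z, Cmod (z - a) < rad -> Cmod (f z) <= M) ->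
  exists b, cder f' a b.
Proof.
  intros HR D HM.
  assert (H0 : forall z : C, Cmod (z - z) = 0).
  { intros z. replace (z - z)%C with (RtoC 0) by ring. apply Cmod_0. }
  assert (M0 : 0 <= M).
  { eapply Rle_trans; [apply Cmod_ge_0|apply (HM a)]. rewrite H0. lra. }
  assert (tri : forall z w v : C, Cmod (z - v) <= Cmod (z - w) + Cmod (w - v)).
  { intros z w v. replace (z - v)%C with ((z - w) + (w - v))%C by ring. apply Cmod_triangle. }
  assert (shift : forall z h : C, (z + h - z)%C = h) by (intros; ring).
  (* the margin left at each of the nested estimates below is a multiple of rho *)
  set (rho := rad / 16). assert (Hrho : rad = 16 * rho) by (unfold rho; field).
  assert (Rpos : 0 < rho) by (unfold rho; lra).
  set (M1 := 2 * M / (4 * rho)).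
  assert (M10 : 0 <= M1) by (apply Rle_div_r; lra).
  assert (S1 : forall z, Cmod (z - a) < 8 * rho -> Cmod (f' z) <= M1).
  { intros z Hz. apply (cauchy_estimate f z (f' z) (8 * rho)); [lra| |apply D; lra|].
    - intros w Hw. exists (f' w). apply D. specialize (tri w z a). lra.
    - intros w Hw. eapply Rle_trans; [apply Cmod_triangle|]. rewrite Cmod_opp.
      pose proof (HM z ltac:(lra)).
      assert (Cmod (f w) <= M) by (apply HM; specialize (tri w z a); lra). lra. }
  assert (S2 : forall z h, Cmod (z - a) < 8 * rho -> Cmod (z + h - a) < 8 * rho ->
     Cmod (f (z + h)%C - f z) <= M1 * Cmod h).
  { intros z h Hz Hh. rewrite <- (shift z h) at 2.
    apply (mean_value_ineq f f').
    - intros t Ht. apply D. apply Rlt_trans with (8 * rho); [|lra]. apply disc_segment; assumption.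
    - intros t Ht. apply S1. apply disc_segment; assumption. }
  assert (triS : forall z h : C, Cmod (z + h - a) <= Cmod (z - a) + Cmod h).
  { intros z h. replace (z + h - a)%C with ((z - a) + h)%C by ring. apply Cmod_triangle. }
  assert (Dsh : forall h w, Cmod (w + h - a) < rad -> cder (fun w => f (w + h))%C w (f' (w + h)%C)).
  { intros h w Hw. eapply cder_eq; [apply (cder_comp f (fun w => w + h)%C); [apply D, Hw|]|].
    - apply cder_plus; [apply cder_id|apply cder_const].
    - ring. }
  set (M2 := 2 * M1 / rho).
  assert (M20 : 0 <= M2) by (apply Rle_div_r; lra).
  assert (S3 : forall z h, Cmod (z - a) < 2 * rho -> Cmod h < 4 * rho ->
     Cmod (f' (z + h)%C - f' z) <= M2 * Cmod h).
  { intros z h Hz Hh. replace (M2 * Cmod h) with (2 * M1 * Cmod h / rho) by (unfold M2; field; lra).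
    assert (Hd : forall w, Cmod (w - z) < 2 * rho ->
      cder (fun w => f (w + h) - f w)%C w (f' (w + h) - f' w)%C).
    { intros w Hw. specialize (tri w z a). specialize (triS w h).
      apply cder_minus; [apply Dsh|apply D]; lra. }
    apply (cauchy_estimate (fun w => f (w + h) - f w)%C z _ (2 * rho)); [lra| | |].
    - intros w Hw. eexists. apply Hd, Hw.
    - apply (Hd z). rewrite H0. lra.
    - intros w Hw. eapply Rle_trans; [apply Cmod_triangle|]. rewrite Cmod_opp.
      assert (Cmod (f (w + h)%C - f w) <= M1 * Cmod h).
      { specialize (tri w z a). specialize (triS w h). apply S2; lra. }
      assert (Cmod (f (z + h)%C - f z) <= M1 * Cmod h).
      { specialize (triS z h). apply S2; lra. }
      lra. }
  assert (S4 : forall z h, Cmod (z - a) < 2 * rho -> Cmod h < 4 * rho ->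
     Cmod (f (z + h)%C - f z - f' z * h) <= M2 * Cmod h * Cmod h).
  { intros z h Hz Hh.
    replace (f (z + h)%C - f z - f' z * h)%C with
      ((f (z + h)%C - f' z * (z + h)) - (f z - f' z * z))%C by ring.
    rewrite <- (shift z h) at 4.
    apply (mean_value_ineq (fun w => f w - f' z * w)%C (fun w => f' w - f' z)%C).
    - intros t Ht. rewrite shift.
      assert (Cmod (RtoC t * h) <= Cmod h).
      { rewrite Cmod_mult, Cmod_R, Rabs_pos_eq by lra. pose proof (Cmod_ge_0 h). nra. }
      specialize (triS z (RtoC t * h)%C).
      apply cder_minus; [apply D; lra|].
      eapply cder_eq; [apply (cder_mult (fun _ => f' z) (fun w => w)); [apply cder_const|apply cder_id]|].
      simpl. ring.
    - intros t Ht. rewrite shift.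
      assert (Cmod (RtoC t * h) <= Cmod h).
      { rewrite Cmod_mult, Cmod_R, Rabs_pos_eq by lra. pose proof (Cmod_ge_0 h). nra. }
      eapply Rle_trans; [apply S3; lra|]. apply Rmult_le_compat_l; lra. }
  set (Q := fun h => ((f' (a + h) - f' a) / h)%C).
  set (K := 2 * M2 / rho).
  assert (K0 : 0 <= K) by (apply Rle_div_r; lra).
  destruct (punctured_limit Q rho K Rpos K0) as [b Hb].
  { intros h k Hh Hk.
    assert (Nh : h <> 0%C) by (apply Cmod_gt_0; lra).
    assert (Nk : k <> 0%C) by (apply Cmod_gt_0; lra).
    set (u := fun w => ((f (w + h) - f w) / h - (f (w + k) - f w) / k)%C).
    assert (Hdiv : forall l w : C, l <> 0%C -> Cmod l < rho -> Cmod (w - a) < 2 * rho ->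
      cder (fun w => (f (w + l) - f w) / l)%C w ((f' (w + l) - f' w) / l)%C).
    { intros l w Nl Hl Hw. specialize (triS w l).
      eapply cder_eq; [apply (cder_mult (fun w => f (w + l) - f w)%C (fun _ => / l)%C)|].
      - apply cder_minus; [apply Dsh|apply D]; lra.
      - apply cder_const.
      - simpl. field. exact Nl. }
    assert (Hu : forall w, Cmod (w - a) < 2 * rho -> Cmod (u w) <= M2 * (Cmod h + Cmod k)).
    { intros w Hw.
      assert (X : forall l : C, l <> 0%C -> Cmod l < rho ->
         Cmod ((f (w + l)%C - f w) / l - f' w) <= M2 * Cmod l).
      { intros l Nl Hl.
        replace ((f (w + l)%C - f w) / l - f' w)%C with
          ((f (w + l)%C - f w - f' w * l) / l)%C by (field; exact Nl).
        rewrite Cmod_div by exact Nl. apply Rle_div_l; [apply Cmod_gt_0, Nl|]. apply S4; lra. }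
      replace (u w) with (((f (w + h)%C - f w) / h - f' w) + - ((f (w + k)%C - f w) / k - f' w))%C
        by (unfold u; ring).
      eapply Rle_trans; [apply Cmod_triangle|]. rewrite Cmod_opp.
      pose proof (X h Nh ltac:(lra)). pose proof (X k Nk ltac:(lra)). lra. }
    replace (K * (Cmod h + Cmod k)) with (2 * (M2 * (Cmod h + Cmod k)) / rho)
      by (unfold K; field; lra).
    assert (Du : forall w, Cmod (w - a) < 2 * rho -> cder u w
      ((f' (w + h) - f' w) / h - (f' (w + k) - f' w) / k)%C).
    { intros w Hw. apply cder_minus; apply Hdiv; auto; lra. }
    apply (cauchy_estimate u a _ (2 * rho)); [lra| | |].
    - intros w Hw. eexists. apply Du, Hw.
    - apply Du. rewrite H0. lra.
    - intros w Hw. eapply Rle_trans; [apply Cmod_triangle|]. rewrite Cmod_opp.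
      pose proof (Hu w ltac:(lra)). pose proof (Hu a ltac:(rewrite H0; lra)). lra. }
  exists b. intros eps He.
  assert (Hk : 0 < eps / (K + 1)) by (apply Rdiv_lt_0_compat; lra).
  exists (Rmin rho (eps / (K + 1))). split; [apply Rmin_pos; lra|].
  intros w Hw. pose proof (Rmin_l rho (eps / (K + 1))). pose proof (Rmin_r rho (eps / (K + 1))).
  pose proof (Cmod_ge_0 (w - a)) as Hge.
  destruct (Req_dec (Cmod (w - a)) 0) as [Z|Z].
  - apply Cmod_eq_0 in Z. replace w with a by (rewrite <- (Cplus_0_l a), <- Z; ring).
    replace (f' a - f' a - b * (a - a))%C with (RtoC 0) by ring.
    rewrite H0, Cmod_0. lra.
  - assert (Nh : (w - a)%C <> 0%C) by (apply Cmod_gt_0; lra).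
    specialize (Hb (w - a)%C ltac:(lra)). unfold Q in Hb.
    replace (a + (w - a))%C with w in Hb by ring.
    replace (f' w - f' a - b * (w - a))%C with
      (((f' w - f' a) / (w - a) - b) * (w - a))%C by (field; exact Nh).
    rewrite Cmod_mult. apply Rmult_le_compat_r; [exact Hge|].
    eapply Rle_trans; [apply Hb|].
    apply Rle_trans with ((K + 1) * (eps / (K + 1))); [|right; field; lra].
    apply Rmult_le_compat; lra.
Qed.

Theorem derivative_differentiable (f : C -> C) (a : C) (rad : R) :
  0 < rad -> differentiable_on_disc f a rad -> exists b, cder (C_derive f) a b.
Proof.
  intros HR Hf.
  assert (H0 : Cmod (a - a) = 0).
  { replace (a - a)%C with (RtoC 0) by ring. apply Cmod_0. }
  destruct (Hf a ltac:(lra)) as [e He].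
  destruct (cder_cont _ _ _ He 1 Rlt_0_1) as [d [Hd Hw]].
  pose proof (Rmin_l rad d). pose proof (Rmin_r rad d).
  apply (derivative_differentiable_bounded f (C_derive f) a (Rmin rad d) (Cmod (f a) + 1)).
  - apply Rmin_pos; assumption.
  - intros z Hz. apply cder_derive, Hf. lra.
  - intros z Hz. specialize (Hw z ltac:(lra)). pose proof (Cmod_le_add (f z) (f a)). lra.
Qed.

(** * Primitives and square roots on a disc *)

Lemma hside_swap f a b c :
  (forall x, Rmin a b <= x <= Rmax a b -> ccont f (x, c)) ->
  hside f b a c = (- hside f a b c)%C.
Proof.
  intros H. symmetry. apply (@opp_RInt_swap C_R_CompleteNormedModule).
  apply ex_RIntC_cont. intros t Ht. apply hside_cont, H, Ht.
Qed.

Lemma vside_swap f a c d :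
  (forall y, Rmin c d <= y <= Rmax c d -> ccont f (a, y)) ->
  vside f a d c = (- vside f a c d)%C.
Proof.
  intros H. symmetry. apply (@opp_RInt_swap C_R_CompleteNormedModule).
  apply ex_RIntC_cont. intros t Ht. apply vside_cont, H, Ht.
Qed.

Lemma Goursat_oriented f a b c d :
  differentiable_on_rect f (Rmin a b) (Rmax a b) (Rmin c d) (Rmax c d) ->
  boundary_integral f a b c d = 0%C.
Proof.
  intros H.
  assert (Cf : forall x y, Rmin a b <= x <= Rmax a b -> Rmin c d <= y <= Rmax c d ->
     ccont f (x, y)) by (intros x y; apply diff_rect_cont; exact H).
  assert (G := Goursat f _ _ _ _ (Rminmax a b) (Rminmax c d) H).
  pose proof (Rmin_l a b). pose proof (Rmin_r a b). pose proof (Rmax_l a b).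
  pose proof (Rmax_r a b). pose proof (Rmin_l c d). pose proof (Rmin_r c d).
  pose proof (Rmax_l c d). pose proof (Rmax_r c d).
  assert (Hc := hside_swap f a b c ltac:(intros; apply Cf; lra)).
  assert (Hd := hside_swap f a b d ltac:(intros; apply Cf; lra)).
  assert (Va := vside_swap f a c d ltac:(intros; apply Cf; lra)).
  assert (Vb := vside_swap f b c d ltac:(intros; apply Cf; lra)).
  revert G. unfold boundary_integral.
  destruct (Rle_dec a b); destruct (Rle_dec c d);
    [rewrite (Rmin_left a b), (Rmax_right a b), (Rmin_left c d), (Rmax_right c d) by lra
    |rewrite (Rmin_left a b), (Rmax_right a b), (Rmin_right c d), (Rmax_left c d) by lra
    |rewrite (Rmin_right a b), (Rmax_left a b), (Rmin_left c d), (Rmax_right c d) by lra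
    |rewrite (Rmin_right a b), (Rmax_left a b), (Rmin_right c d), (Rmax_left c d) by lra];
    intros G; [exact G|..]; rewrite ?Hc, ?Hd, ?Va, ?Vb in G.
  - rewrite <- (Copp_0), <- G. ring.
  - rewrite <- (Copp_0), <- G. ring.
  - rewrite <- G. ring.
Qed.

Lemma Cmod_mono (x y x' y' : R) :
  Rabs x <= Rabs x' -> Rabs y <= Rabs y' -> Cmod (x, y) <= Cmod (x', y').
Proof.
  intros Hx Hy. unfold Cmod. apply sqrt_le_1_alt. simpl.
  apply Rsqr_le_abs_1 in Hx, Hy. unfold Rsqr in *. lra.
Qed.

Lemma between_Rabs (a x s : R) :
  Rmin a x <= s <= Rmax a x -> Rabs (s - a) <= Rabs (x - a).
Proof.
  unfold Rmin, Rmax. destruct (Rle_dec a x); intros H; unfold Rabs;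
   repeat destruct Rcase_abs; lra.
Qed.

(** Integrate from the centre horizontally, then vertically. By Goursat's
    theorem the increment of this function between two nearby points is the
    integral along an L-shaped path joining them. *)
Theorem primitive_on_disc (q : C -> C) (a : C) (rad : R) :
  differentiable_on_disc q a rad ->
  exists F, forall z, Cmod (z - a) < rad -> cder F z (q z).
Proof.
  intros Hq. destruct a as [al be].
  exists (fun z => (hside q al (Re z) be + vside q (Re z) be (Im z))%C).
  intros [x y] Hz eps Heps. simpl in Hz.
  assert (Cq : forall z, Cmod (z - (al, be)) < rad -> ccont q z).
  { intros z Hz'. destruct (Hq z Hz') as [e He]. exact (cder_cont _ _ _ He). }
  destruct (Cq (x, y) Hz (eps / 2)) as [d [Hd Hw]]; [lra|].
  set (del := Rmin d (rad - Cmod ((x, y) - (al, be)))).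
  exists del. split; [apply Rmin_pos; lra|]. intros [x' y'] Hlt.
  assert (L1 : del <= d) by apply Rmin_l.
  assert (L2 : del <= rad - Cmod ((x, y) - (al, be))) by apply Rmin_r.
  set (rw := Cmod ((x', y') - (x, y))) in *.
  (* the two boxes swept by the L-shaped paths stay in the disc *)
  assert (Near : forall s t, Rabs (s - x) <= Rabs (x' - x) -> Rabs (t - y) <= Rabs (y' - y) ->
     Cmod ((s, t) - (x, y)) <= rw).
  { intros s t Hs Ht. apply (Cmod_mono (s - x) (t - y) (x' - x) (y' - y)); assumption. }
  assert (NearD : forall s t, Rabs (s - x) <= Rabs (x' - x) -> Rabs (t - y) <= Rabs (y' - y) ->
     Cmod ((s, t) - (al, be)) < rad).
  { intros s t Hs Ht. specialize (Near s t Hs Ht).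
    replace ((s, t) - (al, be))%C with (((s, t) - (x, y)) + ((x, y) - (al, be)))%C by ring.
    eapply Rle_lt_trans; [apply Cmod_triangle|]. lra. }
  assert (BoxD : forall s t, Rabs (s - x) <= Rabs (x' - x) -> Rabs (t - be) <= Rabs (y - be) ->
     Cmod ((s, t) - (al, be)) < rad).
  { intros s t Hs Ht.
    replace ((s, t) - (al, be))%C with ((s - x, 0)%R + (x - al, t - be)%R)%C
      by (apply injective_projections; simpl; ring).
    eapply Rle_lt_trans; [apply Cmod_triangle|].
    assert (Cmod (s - x, 0) <= rw).
    { apply (Cmod_mono (s - x) 0 (x' - x) (y' - y)); [exact Hs|].
      rewrite Rabs_R0. apply Rabs_pos. }
    assert (Cmod (x - al, t - be) <= Cmod ((x, y) - (al, be))).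
    { apply (Cmod_mono _ _ (x - al) (y - be)); [apply Rle_refl|exact Ht]. }
    lra. }
  assert (BaseD : forall s, Rabs (s - al) <= Rabs (x - al) -> Cmod ((s, be) - (al, be)) < rad).
  { intros s Hs. eapply Rle_lt_trans; [|exact Hz].
    apply (Cmod_mono (s - al) (be - be) (x - al) (y - be)); [exact Hs|].
    rewrite Rminus_diag, Rabs_R0. apply Rabs_pos. }
  assert (Z0 : forall u v : R, Rabs (u - u) <= Rabs v).
  { intros u v. rewrite Rminus_diag, Rabs_R0. apply Rabs_pos. }
  simpl Re. simpl Im.
  rewrite (hside_Chasles q al x' x be), (vside_Chasles q x' be y' y).
  2: { intros t Ht. apply Cq.
       assert (K : Rmin be y <= t <= Rmax be y \/ Rmin y y' <= t <= Rmax y y').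
       { revert Ht. unfold Rmin, Rmax. repeat destruct Rle_dec; lra. }
       destruct K as [K|K].
       - apply BoxD; [lra|apply between_Rabs, K].
       - apply NearD; [lra|apply between_Rabs, K]. }
  2: { intros s Hs. apply Cq.
       assert (K : Rmin al x <= s <= Rmax al x \/ Rmin x x' <= s <= Rmax x x').
       { revert Hs. unfold Rmin, Rmax. repeat destruct Rle_dec; lra. }
       destruct K as [K|K].
       - apply BaseD, between_Rabs, K.
       - apply BoxD; [apply between_Rabs, K|apply Z0]. }
  assert (G : boundary_integral q x x' be y = 0%C).
  { apply Goursat_oriented. intros s t Hs Ht. apply Hq, BoxD; apply between_Rabs; assumption. }
  unfold boundary_integral in G.
  set (k := q (x, y)).
  match goal with |- Cmod ?e <= _ => replace e with
    ((hside q x x' y - (k * (x', y) - k * (x, y)))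
     + (vside q x' y y' - (k * (x', y') - k * (x', y)))
     + (hside q x x' be + vside q x' be y - hside q x x' y - vside q x be y))%C by ring end.
  rewrite G, Cplus_0_r.
  assert (Dk : forall z, cder (fun z => k * z)%C z k).
  { intros z. eapply cder_eq; [apply (cder_mult (fun _ => k) (fun z => z));
      [apply cder_const|apply cder_id]|]. simpl. ring. }
  assert (B1 : Cmod (hside q x x' y - (k * (x', y) - k * (x, y))) <= Rabs (x' - x) * (eps / 2)).
  { apply (hside_close q (fun z => k * z)%C (fun _ => k)).
    - intros s Hs. apply Cq, NearD; [apply between_Rabs, Hs|apply Z0].
    - intros s Hs. apply Dk.
    - intros s Hs. apply (cder_cont _ _ _ (cder_const k _)).
    - intros s Hs. left. apply Hw.
      eapply Rle_lt_trans; [apply Near; [apply between_Rabs, Hs|apply Z0]|lra]. }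
  assert (B2 : Cmod (vside q x' y y' - (k * (x', y') - k * (x', y))) <= Rabs (y' - y) * (eps / 2)).
  { apply (vside_close q (fun z => k * z)%C (fun _ => k)).
    - intros s Hs. apply Cq, NearD; [lra|apply between_Rabs, Hs].
    - intros s Hs. apply Dk.
    - intros s Hs. apply (cder_cont _ _ _ (cder_const k _)).
    - intros s Hs. left. apply Hw.
      eapply Rle_lt_trans; [apply Near; [lra|apply between_Rabs, Hs]|lra]. }
  eapply Rle_trans; [apply Cmod_triangle|].
  pose proof (re_le_Cmod ((x', y') - (x, y))). pose proof (Cmod_im_le ((x', y') - (x, y))).
  fold rw in H, H0. simpl in H, H0.
  assert (Rabs (x' - x) * (eps / 2) <= rw * (eps / 2)) by (apply Rmult_le_compat_r; [lra|exact H]).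
  assert (Rabs (y' - y) * (eps / 2) <= rw * (eps / 2)) by (apply Rmult_le_compat_r; [lra|exact H0]).
  lra.
Qed.

(** A logarithm of [p] is a primitive of p'/p, suitably normalized: multiplying
    [p] by the exponential of its opposite gives a function with derivative 0. *)
Theorem square_root_on_disc (p : C -> C) (a : C) (rad : R) :
  0 < rad -> differentiable_on_disc p a rad ->
  (forall z, Cmod (z - a) < rad -> p z <> 0%C) -> p a = 1%C ->
  exists h, differentiable_on_disc h a rad /\ h a = 1%C /\
    forall z, Cmod (z - a) < rad -> (h z * h z = p z)%C.
Proof.
  intros HR Hp Hnz Ha.
  assert (H0 : Cmod (a - a) = 0).
  { replace (a - a)%C with (RtoC 0) by ring. apply Cmod_0. }
  assert (Dp : forall z, Cmod (z - a) < rad -> cder p z (C_derive p z)).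
  { intros z Hz. apply cder_derive, Hp, Hz. }
  destruct (primitive_on_disc (fun z => C_derive p z / p z)%C a rad) as [F HF].
  { intros z Hz. destruct (derivative_differentiable p z (rad - Cmod (z - a))) as [b Hb]; [lra| |].
    - intros w Hw. apply Hp.
      replace (w - a)%C with ((w - z) + (z - a))%C by ring.
      eapply Rle_lt_trans; [apply Cmod_triangle|]. lra.
    - eexists. apply cder_div; [apply Hnz, Hz|exact Hb|apply Dp, Hz]. }
  set (L := fun z => (F z - F a)%C).
  assert (DL : forall z, Cmod (z - a) < rad -> cder L z (C_derive p z / p z)%C).
  { intros z Hz. eapply cder_eq; [apply cder_minus; [apply HF, Hz|apply cder_const]|]. ring. }
  assert (La : L a = 0%C) by (unfold L; ring).
  set (E := fun z => (p z * Cexp (- L z))%C).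
  assert (DE : forall z, Cmod (z - a) < rad -> cder E z 0).
  { intros z Hz. eapply cder_eq.
    - apply (cder_mult p (fun z => Cexp (- L z))); [apply Dp, Hz|].
      apply (cder_comp Cexp (fun z => - L z)%C); [apply cder_Cexp|].
      apply (cder_ext (fun z => 0 - L z)%C); [intros; ring|].
      apply cder_minus; [apply cder_const|apply DL, Hz].
    - simpl. field. apply Hnz, Hz. }
  assert (EL : forall z, Cmod (z - a) < rad -> p z = Cexp (L z)).
  { intros z Hz.
    assert (K : Cmod (E z - E a) <= 0 * Cmod (z - a)).
    { apply (mean_value_ineq E (fun _ => 0%C)).
      - intros t Ht. apply DE, disc_segment; [exact Ht|lra|exact Hz].
      - intros t Ht. rewrite Cmod_0. lra. }
    rewrite Rmult_0_l in K. pose proof (Cmod_ge_0 (E z - E a)).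
    assert (K1 : (E z - E a)%C = 0%C) by (apply Cmod_eq_0; lra).
    assert (K2 : E a = 1%C).
    { unfold E. rewrite La, Ha, Copp_0, Cexp_0. ring. }
    rewrite K2 in K1.
    replace (p z) with (E z * Cexp (L z))%C.
    - replace (E z) with ((E z - 1) + 1)%C by ring. rewrite K1. ring.
    - unfold E. rewrite <- Cmult_assoc, <- Cexp_plus.
      replace (- L z + L z)%C with (RtoC 0) by ring. rewrite Cexp_0. ring. }
  exists (fun z => Cexp (L z / 2)). split; [|split].
  - intros z Hz. eexists. apply (cder_comp Cexp (fun z => L z / 2)%C); [apply cder_Cexp|].
    apply (cder_mult L (fun _ => / 2)%C); [apply DL, Hz|apply cder_const].
  - rewrite La. unfold Cdiv. rewrite Cmult_0_l. apply Cexp_0.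
  - intros z Hz. rewrite <- Cexp_plus, (EL z Hz). f_equal. field.
Qed.

(** * Distortion of injective functions *)

(** The interval of arguments is centred at 2 pi because the slit opposite to an
    argument y has argument y - pi, which must range over [0, 2 pi]. *)
Lemma polar_form (z : C) : z <> 0%C ->
  exists y, PI <= y <= 3 * PI /\ z = Cexp (ln (Cmod z), y).
Proof.
  intros Hz. assert (Hm : 0 < Cmod z) by (apply Cmod_gt_0; exact Hz).
  set (m := Cmod z) in *.
  assert (E : Re z ^ 2 + Im z ^ 2 = m ^ 2) by (symmetry; apply Cmod2_alt).
  set (c := Re z / m). set (s := Im z / m).
  assert (Ecs : s * s = 1 - c * c).
  { unfold s, c. replace (1 - Re z / m * (Re z / m)) with ((m ^ 2 - Re z ^ 2) / m ^ 2) by (field; lra).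
    replace (m ^ 2 - Re z ^ 2) with (Im z ^ 2) by lra. field. lra. }
  assert (Hc : -1 <= c <= 1) by nra.
  pose proof (acos_bound c) as Ha. pose proof PI_RGT_0.
  assert (Hs : sin (acos c) = Rabs s).
  { rewrite sin_acos by exact Hc. unfold Rsqr. rewrite <- Ecs. apply sqrt_Rsqr_abs. }
  assert (Hfin : forall y, cos y = c -> sin y = s -> z = Cexp (ln m, y)).
  { intros y Hcy Hsy. unfold Cexp. simpl Re. simpl Im. rewrite exp_ln by exact Hm.
    rewrite Hcy, Hsy. unfold c, s. rewrite (surjective_pairing z) at 1.
    apply injective_projections; simpl; unfold Re, Im; field; lra. }
  destruct (Rle_dec 0 s) as [S|S].
  - exists (acos c + 2 * PI). split; [lra|]. apply Hfin.
    + rewrite cos_plus, cos_2PI, sin_2PI, cos_acos by exact Hc. ring.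
    + rewrite sin_plus, cos_2PI, sin_2PI, Hs, Rabs_pos_eq by exact S. ring.
  - exists (- acos c + 2 * PI). split; [lra|]. apply Hfin.
    + rewrite cos_plus, cos_2PI, sin_2PI, cos_neg, cos_acos by exact Hc. ring.
    + rewrite sin_plus, cos_2PI, sin_2PI, sin_neg, Hs, Rabs_left by lra. ring.
Qed.

Lemma Rabs_Cmod_sub (z w : C) : Rabs (Cmod z - Cmod w) <= Cmod (z - w).
Proof.
  pose proof (Cmod_le_add z w). pose proof (Cmod_le_add w z) as H1.
  rewrite Cmod_minus_sym in H1. apply Rabs_le. lra.
Qed.

Lemma continuity_pt_eps (g : R -> R) (t : R) :
  (forall eps, 0 < eps -> exists delta, 0 < delta /\
     forall s, Rabs (s - t) < delta -> Rabs (g s - g t) < eps) -> continuity_pt g t.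
Proof.
  intros H eps He. destruct (H eps He) as [d [Hd Hs]]. exists d. split; [exact Hd|].
  intros s [_ Hlt]. apply Hs. exact Hlt.
Qed.

Lemma Cmod_vertical (x s t : R) : Cmod ((x, s) - (x, t)) = Rabs (s - t).
Proof.
  replace ((x, s) - (x, t))%C with (Ci * RtoC (s - t))%C
    by (apply injective_projections; simpl; ring).
  rewrite Cmod_mult, Cmod_Ci, Cmod_R. ring.
Qed.

Lemma min_on_circle (f : C -> C) (a : C) (r : R) :
  0 < r -> (forall z, Cmod (z - a) = r -> ccont f z) ->
  exists b, Cmod (b - a) = r /\
    forall z, Cmod (z - a) = r -> Cmod (f b) <= Cmod (f z).
Proof.
  intros Hr Hf. pose proof PI_RGT_0.
  set (b := fun t => (a + Cexp (ln r, t))%C).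
  assert (Hb : forall t, Cmod (b t - a) = r).
  { intros t. unfold b. replace (a + Cexp (ln r, t) - a)%C with (Cexp (ln r, t)) by ring.
    rewrite Cmod_Cexp. apply exp_ln, Hr. }
  destruct (continuity_ab_min (fun t => Cmod (f (b t))) PI (3 * PI)) as [t0 [Ht0 _]]; [lra| |].
  - intros t _. apply continuity_pt_eps. intros eps He.
    destruct (Hf (b t) (Hb t) eps He) as [d [Hd Hw]].
    assert (D : cder (fun w => a + Cexp w)%C (ln r, t) (0 + Cexp (ln r, t))%C)
      by (apply cder_plus; [apply cder_const|apply cder_Cexp]).
    destruct (cder_cont _ _ _ D d Hd) as [d' [Hd' Hw']].
    exists d'. split; [exact Hd'|]. intros s Hs.
    eapply Rle_lt_trans; [apply Rabs_Cmod_sub|]. apply Hw.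
    apply (Hw' (ln r, s)). rewrite Cmod_vertical. exact Hs.
  - exists (b t0). split; [apply Hb|]. intros z Hz.
    destruct (polar_form (z - a)%C) as [y [Hy E]].
    { apply Cmod_gt_0. lra. }
    specialize (Ht0 y Hy). replace z with (b y); [exact Ht0|].
    unfold b. rewrite <- Hz, <- E. ring.
Qed.

Lemma Cmod_self (a : C) : Cmod (a - a) = 0.
Proof. replace (a - a)%C with (RtoC 0) by ring. apply Cmod_0. Qed.

Lemma Cmod_minus_triangle (z w v : C) : Cmod (z - v) <= Cmod (z - w) + Cmod (w - v).
Proof. replace (z - v)%C with ((z - w) + (w - v))%C by ring. apply Cmod_triangle. Qed.

(** Koebe's trick. If h^2 is injective then [h] cannot take two opposite
    non-zero values. Since h = 1 at the centre while h^2 stays away from 1 on a circle, the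
    maximum principle applied to 1 / (h - sg) forces [h] to take every value
    [sg] near 1; hence it omits every value near -1. *)
Lemma root_omits_disc (h : C -> C) (a : C) (S r : R) :
  0 < r < S -> differentiable_on_disc h a S -> h a = 1%C ->
  (forall z w, Cmod (z - a) < S -> Cmod (w - a) < S -> (h z * h z = h w * h w)%C -> z = w) ->
  (forall z, Cmod (z - a) = r -> 1 / 2 <= Cmod (h z * h z - 1)) ->
  forall z, Cmod (z - a) < S -> 1 / 20 <= Cmod (h z + 1).
Proof.
  intros Hr Hh Ha Hinj Hbig z1 Hz1. apply Rnot_lt_le. intros Hlt.
  set (s := (- (h z1 + 1))%C).
  assert (Hs : Cmod s < 1 / 20) by (unfold s; rewrite Cmod_opp; exact Hlt).
  set (sg := (1 + s)%C).
  assert (E1 : h z1 = (- sg)%C) by (unfold sg, s; ring).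
  assert (Hsg : 19 / 20 <= Cmod sg).
  { pose proof (Cmod_le_add 1 (- s)). rewrite Cmod_1, Cmod_opp in H.
    replace (1 - - s)%C with sg in H by (unfold sg; ring). lra. }
  assert (Hsg' : Cmod sg <= 21 / 20).
  { unfold sg. eapply Rle_trans; [apply Cmod_triangle|]. rewrite Cmod_1. lra. }
  assert (Hex : exists z2, Cmod (z2 - a) < S /\ h z2 = sg).
  { apply NNPP. intros Hno.
    assert (Hne : forall z, Cmod (z - a) < S -> (h z - sg)%C <> 0%C).
    { intros z Hz E. apply Hno. exists z. split; [exact Hz|].
      replace (h z) with ((h z - sg) + sg)%C by ring. rewrite E. ring. }
    assert (B : Cmod (/ (h a - sg)) <= 10).
    { apply (max_principle (fun z => / (h z - sg))%C a S r); [exact Hr| |].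
      - intros z Hz. destruct (Hh z Hz) as [e He]. eexists.
        apply (cder_inv (fun z => h z - sg)%C); [apply Hne, Hz|].
        apply cder_minus; [exact He|apply cder_const].
      - intros z Hz. rewrite Cmod_inv by (apply Hne; lra).
        (* where h - sg is small, h + sg is bounded; but their product
           h^2 - sg^2 is bounded below *)
        assert (L : 1 / 10 <= Cmod (h z - sg)).
        { apply Rnot_lt_le. intros K.
          assert (K1 : Cmod (h z + sg) <= 1 / 10 + 21 / 10).
          { replace (h z + sg)%C with ((h z - sg) + (sg + sg))%C by ring.
            eapply Rle_trans; [apply Cmod_triangle|]. pose proof (Cmod_triangle sg sg). lra. }
          specialize (Hbig z Hz).
          assert (K2 : Cmod (h z * h z - sg * sg) < 22 / 100).
          { replace (h z * h z - sg * sg)%C with ((h z - sg) * (h z + sg))%C by ring.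
            rewrite Cmod_mult. pose proof (Cmod_ge_0 (h z - sg)).
            pose proof (Cmod_ge_0 (h z + sg)). nra. }
          assert (K3 : Cmod (sg * sg - 1) <= 1 / 20 * (41 / 20)).
          { replace (sg * sg - 1)%C with (s * (sg + 1))%C by (unfold sg; ring).
            rewrite Cmod_mult. apply Rmult_le_compat; try apply Cmod_ge_0; [lra|].
            eapply Rle_trans; [apply Cmod_triangle|]. rewrite Cmod_1. lra. }
          pose proof (Cmod_minus_triangle (h z * h z) (sg * sg) 1). lra. }
        replace 10 with (/ (1 / 10)) by field. apply Rinv_le_contravar; lra. }
    assert (Hn := Hne a ltac:(rewrite Cmod_self; lra)).
    rewrite Cmod_inv in B by exact Hn.
    apply Cmod_gt_0 in Hn. rewrite Ha in *.
    replace (1 - sg)%C with (- s)%C in * by (unfold sg; ring). rewrite Cmod_opp in *.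
    assert (/ (1 / 20) <= / Cmod s) by (apply Rinv_le_contravar; lra).
    replace (/ (1 / 20)) with 20 in * by field. lra. }
  destruct Hex as [z2 [Hz2 E2]].
  assert (E : z1 = z2).
  { apply Hinj; try assumption. rewrite E1, E2. ring. }
  subst z2. rewrite E1 in E2.
  assert (Z : (2 * sg = 0)%C).
  { replace (2 * sg)%C with (sg + sg)%C by ring. rewrite <- E2 at 1. ring. }
  assert (Cmod (2 * sg) = 0) by (rewrite Z; apply Cmod_0).
  rewrite Cmod_mult, Cmod_R, Rabs_pos_eq in H by lra. lra.
Qed.

(** Quasi-symmetry of injective holomorphic functions, a weak form of the Koebe
    distortion theorem. Let [m] be the least value of |f - f a| on the circle;
    it suffices to bound |f - f a| by 48 m near [a]. A value of [f] attained
    just outside the circle is omitted inside, so 1 - (f - f a) / A has a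
    square root [h], and [h] omits a disc about -1. Then 1 / (h + 1) is
    bounded, hence Lipschitz near [a] by the Cauchy estimate, which keeps it
    away from 0 there and so bounds [h], and [f], from above. *)
Theorem injective_distortion (f : C -> C) (a : C) (rad r : R) :
  0 < r < rad -> differentiable_on_disc f a rad ->
  injective_on (fun z => Cmod (z - a) < rad) f ->
  forall z w, Cmod (z - a) <= r / 640 -> Cmod (w - a) = r ->
  Cmod (f z - f a) <= 48 * Cmod (f w - f a).
Proof.
  intros Hr Hf Hinj z0 w0 Hz0 Hw0.
  destruct (min_on_circle (fun z => f z - f a)%C a r) as [b0 [Hb0 Hmin]]; [lra| |].
  { intros z Hz. destruct (Hf z) as [e He]; [lra|].
    apply (cder_cont _ _ (e - 0)%C). apply cder_minus; [exact He|apply cder_const]. }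
  cbv beta in Hmin. set (m := Cmod (f b0 - f a)) in *.
  assert (Hm : 0 < m).
  { apply Cmod_gt_0. intros E. assert (b0 = a); [|subst b0; rewrite Cmod_self in Hb0; lra].
    apply Hinj; [lra|rewrite Cmod_self; lra|].
    replace (f b0) with ((f b0 - f a) + f a)%C by ring. rewrite E. ring. }
  destruct (Hf b0) as [e0 He0]; [lra|].
  destruct (cder_cont _ _ _ He0 m Hm) as [d [Hd Hw]]. clear e0 He0.
  (* pushing b0 slightly outwards makes f b an omitted value on a disc of
     radius S > r while keeping it comparable with m *)
  set (eta := Rmin (d / 2) ((rad - r) / 2) / r).
  assert (Heta0 : 0 < Rmin (d / 2) ((rad - r) / 2)) by (apply Rmin_pos; lra).
  assert (Heta : 0 < eta) by (apply Rdiv_lt_0_compat; lra).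
  assert (Heta' : eta * r = Rmin (d / 2) ((rad - r) / 2)) by (unfold eta; field; lra).
  pose proof (Rmin_l (d / 2) ((rad - r) / 2)). pose proof (Rmin_r (d / 2) ((rad - r) / 2)).
  set (b := (b0 + RtoC eta * (b0 - a))%C).
  set (S := (1 + eta) * r).
  assert (Hba : Cmod (b - a) = S).
  { replace (b - a)%C with (RtoC (1 + eta) * (b0 - a))%C
      by (unfold b; rewrite RtoC_plus; ring).
    rewrite Cmod_mult, Cmod_R, Hb0, Rabs_pos_eq by lra. reflexivity. }
  assert (HS : r < S < rad) by (unfold S; nra).
  assert (Hb1 : Cmod (f b - f b0) < m).
  { apply Hw. replace (b - b0)%C with (RtoC eta * (b0 - a))%C by (unfold b; ring).
    rewrite Cmod_mult, Cmod_R, Hb0, Rabs_pos_eq by lra. lra. }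
  set (A := (f b - f a)%C).
  assert (HA : Cmod A < 2 * m).
  { pose proof (Cmod_minus_triangle (f b) (f b0) (f a)). unfold A, m in *. lra. }
  assert (HA0 : A <> 0%C).
  { intros E. assert (Eb : b = a); [|rewrite Eb, Cmod_self in Hba; lra].
    apply Hinj; [lra|rewrite Cmod_self; lra|].
    replace (f b) with (A + f a)%C by (unfold A; ring). rewrite E. ring. }
  assert (HA1 : 0 < Cmod A) by (apply Cmod_gt_0; exact HA0).
  set (p := fun z => (1 - (f z - f a) / A)%C).
  destruct (square_root_on_disc p a S) as [h [Dh [Ha Hh]]]; [lra| | | |].
  { intros z Hz. destruct (Hf z) as [e He]; [lra|]. eexists.
    apply cder_minus; [apply cder_const|].
    apply (cder_mult (fun z => f z - f a)%C (fun _ => / A)%C); [|apply cder_const].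
    apply cder_minus; [exact He|apply cder_const]. }
  { intros z Hz E. assert (z = b); [|subst z; lra].
    apply Hinj; [lra|lra|].
    replace (f z) with ((1 - p z) * A + f a)%C by (unfold p; field; exact HA0).
    rewrite E. unfold A. ring. }
  { unfold p. field. exact HA0. }
  assert (Hfh : forall z, Cmod (z - a) < S -> (f z - f a = (1 - h z * h z) * A)%C).
  { intros z Hz. rewrite Hh by exact Hz. unfold p. field. exact HA0. }
  assert (Homit : forall z, Cmod (z - a) < S -> 1 / 20 <= Cmod (h z + 1)).
  { apply (root_omits_disc h a S r); [lra|exact Dh|exact Ha| |].
    - intros z w Hz Hw' E. apply Hinj; [lra|lra|].
      replace (f z) with ((f z - f a) + f a)%C by ring.
      rewrite Hfh, E, <- Hfh by assumption. ring.
    - intros z Hz. specialize (Hmin z Hz). fold m in Hmin.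
      replace (h z * h z - 1)%C with (- ((f z - f a) / A))%C.
      + rewrite Cmod_opp, Cmod_div by exact HA0. apply (Rle_div_r (1 / 2) _ _ HA1). lra.
      + rewrite Hfh by lra. field. exact HA0. }
  assert (Hh1 : forall z, Cmod (z - a) < S -> (h z + 1)%C <> 0%C).
  { intros z Hz. apply Cmod_gt_0. specialize (Homit z Hz). lra. }
  (* k is bounded by 20 and equals 1/2 at a; the Lipschitz constant 160 / r on
     half the disc keeps it at least 1/4 in absolute value up to r / 640 *)
  set (k := fun z => (/ (h z + 1))%C).
  assert (Dk : differentiable_on_disc k a S).
  { intros z Hz. destruct (Dh z Hz) as [e He]. eexists.
    apply (cder_inv (fun z => h z + 1)%C); [apply Hh1, Hz|].
    apply cder_plus; [exact He|apply cder_const]. }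
  assert (Bk : forall z, Cmod (z - a) < S -> Cmod (k z) <= 20).
  { intros z Hz. unfold k. rewrite Cmod_inv by (apply Hh1, Hz).
    replace 20 with (/ (1 / 20)) by field. apply Rinv_le_contravar; [lra|]. apply Homit, Hz. }
  assert (Dk' : forall z, Cmod (z - a) < r / 2 -> Cmod (C_derive k z) <= 160 / r).
  { intros z Hz. replace (160 / r) with (40 / (r / 4)) by (field; lra).
    assert (Hin : forall w, Cmod (w - z) < r / 2 -> Cmod (w - a) < S).
    { intros w Hw'. pose proof (Cmod_minus_triangle w z a). lra. }
    apply (cauchy_estimate k z _ (r / 2)); [lra| | |].
    - intros w Hw'. apply Dk, Hin, Hw'.
    - apply cder_derive, Dk. lra.
    - intros w Hw'. eapply Rle_trans; [apply Cmod_triangle|]. rewrite Cmod_opp.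
      pose proof (Bk w ltac:(apply Hin; lra)). pose proof (Bk z ltac:(lra)). lra. }
  assert (Hk : Cmod (k z0 - k a) <= 1 / 4).
  { apply Rle_trans with (160 / r * Cmod (z0 - a)).
    - apply (mean_value_ineq k (C_derive k)); intros t Ht.
      + apply cder_derive, Dk, disc_segment; [exact Ht|rewrite Cmod_self|]; lra.
      + apply Dk', disc_segment; [exact Ht|rewrite Cmod_self|]; lra.
    - apply Rle_trans with (160 / r * (r / 640)); [|right; field; lra].
      apply Rmult_le_compat_l; [|exact Hz0]. left. apply Rdiv_lt_0_compat; lra. }
  assert (Ka : k a = (/ 2)%C).
  { unfold k. rewrite Ha. f_equal. apply injective_projections; simpl; ring. }
  assert (Kz : 1 / 4 <= Cmod (k z0)).
  { assert (Cmod (k a) = 1 / 2).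
    { rewrite Ka, Cmod_inv, Cmod_R, Rabs_pos_eq; [field|lra|].
      intros E; apply (f_equal Re) in E; simpl in E; lra. }
    pose proof (Cmod_le_add (k a) (k z0)) as T. rewrite Cmod_minus_sym in T. lra. }
  assert (Hz0S : Cmod (z0 - a) < S) by lra.
  assert (Hp : Cmod (h z0 + 1) <= 4).
  { unfold k in Kz. rewrite Cmod_inv in Kz by (apply Hh1, Hz0S).
    specialize (Homit z0 Hz0S).
    apply (Rmult_le_compat_r (Cmod (h z0 + 1))) in Kz; [|lra].
    rewrite Rinv_l in Kz by lra. lra. }
  assert (Hq : Cmod (2 - (h z0 + 1)) <= 6).
  { eapply Rle_trans; [apply Cmod_triangle|].
    rewrite Cmod_opp, Cmod_R, Rabs_pos_eq by lra. lra. }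
  rewrite Hfh by exact Hz0S.
  replace (1 - h z0 * h z0)%C with ((h z0 + 1) * (2 - (h z0 + 1)))%C by ring.
  rewrite !Cmod_mult. specialize (Hmin w0 Hw0). fold m in Hmin.
  pose proof (Cmod_ge_0 (h z0 + 1)). pose proof (Cmod_ge_0 (2 - (h z0 + 1))).
  assert (Cmod (h z0 + 1) * Cmod (2 - (h z0 + 1)) <= 24) by nra.
  apply Rle_trans with (24 * Cmod A); [|lra].
  apply Rmult_le_compat_r; lra.
Qed.

(** * Branches of the logarithm on slit discs *)

Notation contCR := (@continuous C_UniformSpace R_UniformSpace).

Lemma contCR_lip (u : C -> R) (z : C) :
  (forall w, Rabs (u w - u z) <= Cmod (w - z)) -> contCR u z.
Proof.
  intros H. apply (filterlim_locally (U := R_UniformSpace)). intros eps.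
  apply locally_Cmod. exists eps. split; [apply cond_pos|].
  intros w Hw. apply Rle_lt_trans with (2 := Hw). apply H.
Qed.

Lemma contCR_eps (u : C -> R) (z : C) : contCR u z ->
  forall eps, 0 < eps -> exists delta, 0 < delta /\
    forall w, Cmod (w - z) < delta -> Rabs (u w - u z) < eps.
Proof.
  intros H eps He.
  assert (K := proj1 (filterlim_locally (U := R_UniformSpace) _ _) H (mkposreal eps He)).
  apply locally_Cmod in K. exact K.
Qed.

Lemma continuous_CC_pair (u v : C -> R) (z : C) :
  contCR u z -> contCR v z ->
  @continuous C_UniformSpace C_UniformSpace (fun w => (u w, v w)) z.
Proof.
  intros Hu Hv. apply (filterlim_locally (U := C_UniformSpace)). intros eps.
  pose proof (is_pos_div_2 eps) as He.
  destruct (contCR_eps u z Hu _ He) as [d1 [Hd1 H1]].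
  destruct (contCR_eps v z Hv _ He) as [d2 [Hd2 H2]].
  apply locally_Cmod. exists (Rmin d1 d2). split; [apply Rmin_pos; assumption|].
  intros w Hw. pose proof (Rmin_l d1 d2). pose proof (Rmin_r d1 d2).
  apply C_NormedModule_mixin_compat1.
  eapply Rle_lt_trans; [apply Cmod_le_Rabs|].
  specialize (H1 w ltac:(lra)). specialize (H2 w ltac:(lra)).
  change (Rabs (u w - u z) + Rabs (v w - v z) < eps). lra.
Qed.

Lemma cos_sin_2atan (X Y m : R) :
  0 < m -> X ^ 2 + Y ^ 2 = m ^ 2 -> 0 < m + X ->
  cos (2 * atan (Y / (m + X))) = X / m /\ sin (2 * atan (Y / (m + X))) = Y / m.
Proof.
  intros Hm E Hp. set (t := Y / (m + X)).
  assert (Ht : 1 + t ^ 2 = 2 * m / (m + X)).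
  { unfold t. field_simplify_eq; [|lra]. nra. }
  assert (Ht0 : 0 < 1 + t ^ 2) by nra.
  assert (Hsq : sqrt (1 + t ^ 2) * sqrt (1 + t ^ 2) = 1 + t ^ 2) by (apply sqrt_sqrt; lra).
  assert (Hs0 : 0 < sqrt (1 + t ^ 2)) by (apply sqrt_lt_R0; exact Ht0).
  rewrite cos_2a_cos, sin_2a, cos_atan, sin_atan. unfold Rsqr.
  replace (1 + t * t) with (1 + t ^ 2) by ring.
  split.
  - replace (2 * (1 / sqrt (1 + t ^ 2)) * (1 / sqrt (1 + t ^ 2)) - 1) with
      (2 / (sqrt (1 + t ^ 2) * sqrt (1 + t ^ 2)) - 1) by (field; lra).
    rewrite Hsq, Ht. field. lra.
  - replace (2 * (t / sqrt (1 + t ^ 2)) * (1 / sqrt (1 + t ^ 2))) with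
      (2 * t / (sqrt (1 + t ^ 2) * sqrt (1 + t ^ 2))) by (field; lra).
    rewrite Hsq, Ht. unfold t. field. lra.
Qed.

Lemma tan_half (d : R) : - PI < d < PI -> sin d / (1 + cos d) = tan (d / 2) /\ 0 < 1 + cos d.
Proof.
  intros Hd. assert (Hc : 0 < cos (d / 2)) by (apply cos_gt_0; lra).
  replace d with (2 * (d / 2)) at 1 2 4 by field.
  rewrite sin_2a, cos_2a_cos. unfold tan.
  assert (0 < cos (d / 2) * cos (d / 2)) by (apply Rmult_lt_0_compat; exact Hc).
  split; [field; split; lra|lra].
Qed.

(** Off the slit, the rotated point z e^(-i y0) avoids the negative half-axis,
    and its argument is 2 atan (Y / (|z| + X)), which is continuous there. *)
Lemma slit_branch (z0 l0 : C) (y0 : R) :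
  z0 = Cexp l0 ->
  exists L, ln_branch (slit_disc (y0 - PI)) z0 L /\
    forall w, Re w < 0 -> Rabs (Im w - y0) < PI ->
      slit_disc (y0 - PI) (Cexp w) /\ L (Cexp w) = (w - l0)%C.
Proof.
  intros Hz0.
  set (X := fun z : C => Re z * cos y0 + Im z * sin y0).
  set (Y := fun z : C => Im z * cos y0 - Re z * sin y0).
  set (arg := fun z => y0 + 2 * atan (Y z / (Cmod z + X z))).
  assert (XY : forall z, X z ^ 2 + Y z ^ 2 = Cmod z ^ 2).
  { intros z. rewrite Cmod2_alt. unfold X, Y.
    pose proof (sin2_cos2 y0) as T. unfold Rsqr in T.
    transitivity ((Re z ^ 2 + Im z ^ 2) * (sin y0 * sin y0 + cos y0 * cos y0)); [ring|].
    rewrite T. ring. }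
  assert (Xpos : forall z, slit_disc (y0 - PI) z -> 0 < Cmod z /\ 0 < Cmod z + X z).
  { intros z [_ Hz].
    assert (Hm : 0 < Cmod z).
    { apply Cmod_gt_0. intros E. apply Hz. left. exact E. }
    split; [exact Hm|]. apply Rnot_le_lt. intros Hle. apply Hz. right.
    exists (ln (Cmod z)). specialize (XY z).
    assert (EX : X z = - Cmod z) by nra. assert (EY : Y z = 0) by nra.
    pose proof (sin2_cos2 y0) as T. unfold Rsqr in T.
    assert (E1 : Re z = X z * cos y0 - Y z * sin y0).
    { unfold X, Y. transitivity (Re z * (sin y0 * sin y0 + cos y0 * cos y0)); [rewrite T|]; ring. }
    assert (E2 : Im z = X z * sin y0 + Y z * cos y0).
    { unfold X, Y. transitivity (Im z * (sin y0 * sin y0 + cos y0 * cos y0)); [rewrite T|]; ring. }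
    rewrite EX, EY in E1, E2.
    replace (ln (Cmod z) + Ci * RtoC (y0 - PI))%C with ((ln (Cmod z), y0 - PI) : C)
      by (apply injective_projections; simpl; ring).
    unfold Cexp. simpl Re at 1. simpl Im at 1. simpl Re at 1. simpl Im.
    rewrite exp_ln by exact Hm. rewrite cos_minus, sin_minus, cos_PI, sin_PI.
    apply injective_projections; simpl.
    - change (fst z) with (Re z). rewrite E1. ring.
    - change (snd z) with (Im z). rewrite E2. ring. }
  exists (fun z => ((ln (Cmod z), arg z) - l0)%C). split; [split|].
  - intros z Hz. destruct (Xpos z Hz) as [Hm Hp].
    assert (CRe : contCR Re z).
    { apply contCR_lip. intros w. apply (re_le_Cmod (w - z)). }
    assert (CIm : contCR Im z).
    { apply contCR_lip. intros w. apply (Cmod_im_le (w - z)). }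
    assert (CM : contCR Cmod z) by (apply contCR_lip; intros w; apply Rabs_Cmod_sub).
    assert (CX : contCR X z).
    { apply (continuous_plus (V := R_NormedModule));
       apply (continuous_mult (K := R_AbsRing)); try assumption; apply continuous_const. }
    assert (CY : contCR Y z).
    { apply (continuous_minus (V := R_NormedModule));
       apply (continuous_mult (K := R_AbsRing)); try assumption; apply continuous_const. }
    apply (continuous_CC_pair (fun z => ln (Cmod z) + - Re l0) (fun z => arg z + - Im l0)).
    + apply (continuous_plus (V := R_NormedModule)); [|apply continuous_const].
      apply (continuous_comp Cmod ln); [exact CM|]. apply continuous_ln, Hm.
    + apply (continuous_plus (V := R_NormedModule)); [|apply continuous_const].
      apply (continuous_plus (V := R_NormedModule)); [apply continuous_const|].
      apply (continuous_mult (K := R_AbsRing)); [apply continuous_const|].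
      apply (continuous_comp (fun z => Y z / (Cmod z + X z)) atan).
      * apply (continuous_mult (K := R_AbsRing)); [exact CY|].
        apply (continuous_comp (fun z => Cmod z + X z) Rinv).
        -- apply (continuous_plus (V := R_NormedModule)); assumption.
        -- apply continuous_Rinv. lra.
      * apply continuous_atan.
  - intros z Hz. destruct (Xpos z Hz) as [Hm Hp].
    destruct (cos_sin_2atan (X z) (Y z) (Cmod z) Hm (XY z) Hp) as [Ec Es].
    assert (E : Cexp (ln (Cmod z), arg z) = z).
    { unfold Cexp. simpl Re. simpl Im. rewrite exp_ln by exact Hm. unfold arg.
      rewrite cos_plus, sin_plus, Ec, Es.
      pose proof (sin2_cos2 y0) as T. unfold Rsqr in T.
      apply injective_projections; simpl.
      - change (fst z) with (Re z). transitivity (cos y0 * X z - sin y0 * Y z); [field; lra|].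
        unfold X, Y. transitivity (Re z * (sin y0 * sin y0 + cos y0 * cos y0)); [|rewrite T]; ring.
      - change (snd z) with (Im z). transitivity (sin y0 * X z + cos y0 * Y z); [field; lra|].
        unfold X, Y. transitivity (Im z * (sin y0 * sin y0 + cos y0 * cos y0)); [|rewrite T]; ring. }
    rewrite <- E at 3. rewrite Hz0.
    set (w := ((ln (Cmod z), arg z) : C)).
    replace (Cexp w) with (Cexp (w - l0) * Cexp l0)%C
      by (rewrite <- Cexp_plus; f_equal; ring).
    field. apply Cexp_neq_0.
  - intros [x y] Hx Hy. simpl in Hx, Hy. apply Rabs_lt_between in Hy.
    destruct (tan_half (y - y0) Hy) as [Ht Hc].
    assert (E1 : X (Cexp (x, y)) = exp x * cos (y - y0)).
    { unfold X, Cexp. simpl. rewrite cos_minus. ring. }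
    assert (E2 : Y (Cexp (x, y)) = exp x * sin (y - y0)).
    { unfold Y, Cexp. simpl. rewrite sin_minus. ring. }
    pose proof (exp_pos x) as Hex. split; [split|].
    + unfold unit_disc. rewrite Cmod_Cexp. simpl. rewrite <- exp_0. apply exp_increasing, Hx.
    + intros [E|[b E]]; [exact (Cexp_neq_0 _ E)|].
      assert (E3 := f_equal X E).
      replace (b + Ci * RtoC (y0 - PI))%C with ((b, y0 - PI) : C) in *
        by (apply injective_projections; simpl; ring).
      assert (E4 := f_equal Cmod E). rewrite !Cmod_Cexp in E4. simpl in E4.
      rewrite E1 in E3. unfold X, Cexp in E3. simpl in E3.
      rewrite <- E4, (cos_minus y0 PI), (sin_minus y0 PI), cos_PI, sin_PI in E3.
      pose proof (sin2_cos2 y0) as T. unfold Rsqr in T.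
      assert (exp x * (1 + cos (y - y0)) = 0).
      { rewrite Rmult_plus_distr_l, E3, Rmult_1_r.
        transitivity (exp x * (1 - (sin y0 * sin y0 + cos y0 * cos y0))); [ring|]. rewrite T. ring. }
      apply Rmult_integral in H. lra.
    + f_equal. unfold arg. rewrite E1, E2, Cmod_Cexp. simpl. rewrite ln_exp. f_equal.
      replace (exp x * sin (y - y0) / (exp x + exp x * cos (y - y0))) with
        (sin (y - y0) / (1 + cos (y - y0))).
      2: { assert (0 < exp x * (1 + cos (y - y0))) by (apply Rmult_lt_0_compat; assumption).
           field; split; lra. }
      rewrite Ht, atan_tan by lra. field.
Qed.

(** The multivalued function phi read in the coordinate w = ln z; the constant
    [l0] is a logarithm of z0. *)
Definition lifted (c l0 : C) (g : C -> C) (w : C) : C :=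
  (g (Cexp w) + c / (2 * PI * Ci) * (w - l0))%C.

(** A strip of height 2 pi is carried by the exponential bijectively onto a slit
    disc, and the lift is there the branch given by [slit_branch]. *)
Lemma lifted_injective (c z0 l0 : C) (g : C -> C) :
  z0 = Cexp l0 ->
  (forall theta : R, 0 <= theta <= 2 * PI ->
     forall phi : C -> C,
       phi_branch (slit_disc theta) c z0 g phi ->
       injective_on (slit_disc theta) phi) ->
  forall y0, PI <= y0 <= 3 * PI ->
  injective_on (fun w => Re w < 0 /\ Rabs (Im w - y0) < PI) (lifted c l0 g).
Proof.
  intros Hz0 H y0 Hy0. destruct (slit_branch z0 l0 y0 Hz0) as [L [HL HLw]].
  intros w1 w2 [H1 H1'] [H2 H2'] E.
  destruct (HLw w1 H1 H1') as [D1 L1]. destruct (HLw w2 H2 H2') as [D2 L2].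
  assert (K : Cexp w1 = Cexp w2).
  { apply (H (y0 - PI) ltac:(lra) (fun z => g z + c / (2 * PI * Ci) * L z)%C).
    - exists L. split; [exact HL|]. reflexivity.
    - exact D1.
    - exact D2.
    - rewrite L1, L2. exact E. }
  assert (K' : (w1 - l0)%C = (w2 - l0)%C) by (rewrite <- L1, <- L2, K; reflexivity).
  replace w1 with ((w1 - l0) + l0)%C by ring. rewrite K'. ring.
Qed.

(** * Growth at the puncture *)

(** The radius attached to a point is also taken below 1 / (1 + |f|) there, so
    that the uniform lower bound on the radii provided by compactness bounds
    the function. *)
Lemma ccont_bounded_box (f : C -> C) (a b c d : R) :
  (forall x y, a <= x <= b -> c <= y <= d -> ccont f (x, y)) ->
  exists B, forall x y, a <= x <= b -> c <= y <= d -> Cmod (f (x, y)) <= B.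
Proof.
  intros Hf.
  assert (E : forall u v, exists del : posreal, a <= u <= b -> c <= v <= d ->
    del <= / (1 + Cmod (f (u, v))) /\
    forall x y, Rabs (x - u) < del -> Rabs (y - v) < del ->
      Cmod (f (x, y)) < 1 + Cmod (f (u, v))).
  { intros u v. destruct (classic (a <= u <= b /\ c <= v <= d)) as [[Hu Hv]|Hn].
    - destruct (Hf u v Hu Hv 1 Rlt_0_1) as [d0 [Hd0 Hw]].
      pose proof (Cmod_ge_0 (f (u, v))).
      assert (P : 0 < Rmin (d0 / 2) (/ (1 + Cmod (f (u, v))))).
      { apply Rmin_pos; [lra|apply Rinv_0_lt_compat; lra]. }
      exists (mkposreal _ P). intros _ _. simpl.
      pose proof (Rmin_l (d0 / 2) (/ (1 + Cmod (f (u, v))))).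
      split; [apply Rmin_r|]. intros x y Hx Hy.
      pose proof (Cmod_le_add (f (x, y)) (f (u, v))).
      assert (Cmod (f (x, y) - f (u, v)) < 1); [|lra].
      apply Hw. eapply Rle_lt_trans; [apply Cmod_le_Rabs|].
      change (Rabs (x - u) + Rabs (y - v) < d0). lra.
    - exists (mkposreal 1 Rlt_0_1). intros; exfalso; apply Hn; split; assumption. }
  set (del := fun u v => proj1_sig (constructive_indefinite_description _ (E u v))).
  destruct (compactness_value_2d a b c d del) as [d0 Hd0].
  exists (/ d0). intros x y Hx Hy. apply Rnot_lt_le. intros Hlt.
  apply (Hd0 x y Hx Hy). intros (u & v & Hu & Hv & Hxu & Hyv & Hle).
  destruct (proj2_sig (constructive_indefinite_description _ (E u v)) Hu Hv) as [K1 K2].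
  fold (del u v) in K1, K2.
  specialize (K2 x y Hxu Hyv). pose proof (Cmod_ge_0 (f (u, v))).
  assert (K3 : 1 + Cmod (f (u, v)) <= / d0).
  { rewrite <- (Rinv_inv (1 + Cmod (f (u, v)))).
    apply Rinv_le_contravar; [apply cond_pos|lra]. }
  lra.
Qed.

(** Discs of radius 2 < pi fit into the strips of injectivity, so the distortion
    theorem applies with one and the same constant at every point. It bounds
    the value one step 1/640 to the left by 97 = 1 + 48 * 2 times a bound
    already known to the right, and this can be iterated. *)
Lemma exponential_growth (F : C -> C) :
  (forall w, Re w < 0 -> exists e, cder F w e) ->
  (forall y0, PI <= y0 <= 3 * PI ->
     injective_on (fun w => Re w < 0 /\ Rabs (Im w - y0) < PI) F) ->
  exists (N : nat) (B : R), 0 <= B /\ forall x y, x <= -1 -> PI <= y <= 3 * PI ->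
    Cmod (F (x, y)) <= B * exp (- INR N * x).
Proof.
  intros HF Hinj.
  (* a centre w is taken with real part below -3, so that its disc of radius 2
     lies in the half-plane and w + 1 in the range of the bound *)
  destruct (ccont_bounded_box F (-4) (-1) PI (3 * PI)) as [B0 HB0].
  { intros x y Hx Hy. destruct (HF (x, y)) as [e He]; [simpl; lra|]. exact (cder_cont _ _ _ He). }
  pose proof PI2_1 as HPI.
  assert (B0pos : 0 <= B0).
  { eapply Rle_trans; [apply Cmod_ge_0|apply (HB0 (-1) PI); lra]. }
  destruct (nfloor_ex (97 * 640)) as [N [_ HN]]; [lra|].
  exists (S N), B0. split; [exact B0pos|].
  rewrite S_INR. set (k := INR N + 1) in *.
  set (e := 1 / 640). assert (He : e = 1 / 640) by reflexivity.
  (* the exponent makes one step cover the factor 97 *)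
  assert (Hk : 97 <= exp (k * e)).
  { pose proof (exp_ineq1_le (k * e)). unfold e in *. lra. }
  assert (Main : forall n x y, -4 - INR n * e <= x -> x <= -1 -> PI <= y <= 3 * PI ->
     Cmod (F (x, y)) <= B0 * exp (- k * x)).
  { induction n as [|n IH]; intros x y Hx1 Hx2 Hy.
    - simpl in Hx1. apply Rle_trans with (B0 * 1).
      + rewrite Rmult_1_r. apply HB0; lra.
      + apply Rmult_le_compat_l; [exact B0pos|].
        pose proof (exp_ineq1_le (- k * x)). assert (0 <= k * - x) by (apply Rmult_le_pos; lra). lra.
    - destruct (Rle_dec (-4 - INR n * e) x) as [Hx|Hx]; [apply IH; assumption|].
      rewrite S_INR in Hx1. pose proof (pos_INR n).
      assert (0 <= INR n * e) by (apply Rmult_le_pos; lra).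
      set (w := ((x + e, y) : C)).
      assert (Hdisc : forall v, Cmod (v - w) < 2 -> Re v < 0 /\ Rabs (Im v - y) < PI).
      { intros v Hv. pose proof (re_le_Cmod (v - w)) as R1. pose proof (Cmod_im_le (v - w)) as R2.
        change (Re (v - w)) with (Re v - (x + e)) in R1.
        change (Im (v - w)) with (Im v - y) in R2.
        pose proof (Rle_abs (Re v - (x + e))). split; lra. }
      assert (D : Cmod (F (x, y) - F w) <= 48 * Cmod (F ((x + e + 1, y) : C) - F w)).
      { apply (injective_distortion F w 2 1); [lra| | | |].
        - intros v Hv. apply HF, Hdisc, Hv.
        - intros v1 v2 Hv1 Hv2. apply (Hinj y Hy); apply Hdisc; assumption.
        - replace ((x, y) - w)%C with (RtoC (- e))
            by (unfold w; apply injective_projections; simpl; ring).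
          rewrite Cmod_R, Rabs_Ropp, Rabs_pos_eq; lra.
        - replace ((x + e + 1, y)%R - w)%C with (RtoC 1)
            by (unfold w; apply injective_projections; simpl; ring).
          apply Cmod_1. }
      assert (I1 : Cmod (F w) <= B0 * exp (- k * (x + e))) by (apply IH; lra).
      assert (I2 : Cmod (F ((x + e + 1, y) : C)) <= B0 * exp (- k * (x + e))).
      { eapply Rle_trans; [apply IH; lra|]. apply Rmult_le_compat_l; [exact B0pos|].
        left. apply exp_increasing. pose proof (pos_INR N). unfold k. lra. }
      pose proof (Cmod_le_add (F (x, y)) (F w)).
      pose proof (Cmod_triangle (F ((x + e + 1, y) : C)) (- F w)) as T.
      rewrite Cmod_opp in T. fold (Cminus (F ((x + e + 1, y) : C)) (F w)) in T.
      apply Rle_trans with (97 * (B0 * exp (- k * (x + e)))); [lra|].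
      replace (- k * x) with (k * e + - k * (x + e)) by ring. rewrite exp_plus.
      assert (0 <= B0 * exp (- k * (x + e))).
      { apply Rmult_le_pos; [exact B0pos|left; apply exp_pos]. }
      replace (B0 * (exp (k * e) * exp (- k * (x + e)))) with
        (exp (k * e) * (B0 * exp (- k * (x + e)))) by ring.
      apply Rmult_le_compat_r; assumption. }
  intros x y Hx Hy. destruct (nfloor_ex (- x * 640)) as [n [_ Hn]]; [lra|].
  apply (Main (S n)); [|exact Hx|exact Hy]. rewrite S_INR, He. lra.
Qed.

(** Since |z| = e^x, exponential growth in x is polynomial growth in 1 / |z|; the
    logarithmic term of [lifted] grows only linearly in x. *)
Lemma polynomial_growth (c l0 : C) (g : C -> C) :
  holomorphic_on punctured_disc g ->
  (forall y0, PI <= y0 <= 3 * PI ->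
     injective_on (fun w => Re w < 0 /\ Rabs (Im w - y0) < PI) (lifted c l0 g)) ->
  exists (N : nat) (B : R), 0 <= B /\ forall z, 0 < Cmod z <= exp (-1) ->
    Cmod (z ^ N * g z)%C <= B.
Proof.
  intros Hg Hinj. set (ga := (c / (2 * PI * Ci))%C).
  destruct (exponential_growth (lifted c l0 g)) as (N & B & HB & H).
  { intros w Hw. assert (P : punctured_disc (Cexp w)).
    { split; [|apply Cexp_neq_0]. unfold unit_disc. rewrite Cmod_Cexp, <- exp_0.
      apply exp_increasing, Hw. }
    apply Hg in P. apply C_differentiable_cder in P. destruct P as [e He].
    eexists. apply (cder_plus (fun w => g (Cexp w)) (fun w => ga * (w - l0))%C).
    - apply (cder_comp g Cexp); [exact He|apply cder_Cexp].
    - apply (cder_mult (fun _ => ga) (fun w => w - l0)%C); [apply cder_const|].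
      apply cder_minus; [apply cder_id|apply cder_const]. }
  { exact Hinj. }
  pose proof PI_RGT_0. pose proof (Cmod_ge_0 ga). pose proof (Cmod_ge_0 l0).
  set (K := Cmod ga * (1 + 3 * PI + Cmod l0)).
  assert (K0 : 0 <= K) by (apply Rmult_le_pos; lra).
  exists (S N), (B + K). split; [lra|]. intros z [Hz Hz1].
  destruct (polar_form z) as [y [Hy E]]; [apply Cmod_gt_0; exact Hz|].
  set (x := ln (Cmod z)) in *.
  assert (Ex : exp x = Cmod z) by (apply exp_ln, Hz).
  assert (Hx : x <= -1).
  { rewrite <- Ex in Hz1. destruct Hz1 as [L|L]; [left; apply exp_lt_inv, L|right; apply exp_inv, L]. }
  specialize (H x y Hx Hy).
  assert (Eg : g z = (lifted c l0 g (x, y) - ga * ((x, y) - l0))%C).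
  { unfold lifted. fold ga. rewrite <- E. ring. }
  assert (B1 : Cmod (g z) <= B * exp (- INR N * x) + K * (- x)).
  { rewrite Eg. eapply Rle_trans; [apply Cmod_triangle|]. rewrite Cmod_opp, Cmod_mult.
    apply Rplus_le_compat; [exact H|].
    unfold K. rewrite Rmult_assoc. apply Rmult_le_compat_l; [assumption|].
    eapply Rle_trans; [apply Cmod_triangle|]. rewrite Cmod_opp.
    pose proof (Cmod_le_Rabs (x, y)) as T. simpl in T.
    rewrite (Rabs_left x), (Rabs_pos_eq y) in T by lra. nra. }
  assert (Ep : exp x ^ N * exp (- INR N * x) = 1).
  { rewrite <- (Rpower_pow N (exp x)) by apply exp_pos.
    unfold Rpower. rewrite ln_exp, <- exp_plus, <- exp_0. f_equal. ring. }
  assert (Hx1 : exp x <= 1) by (rewrite <- exp_0; left; apply exp_increasing; lra).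
  assert (Hx2 : exp x * (- x) <= 1).
  { replace 1 with (exp x * exp (- x)) by (rewrite <- exp_plus, Rplus_opp_r; apply exp_0).
    apply Rmult_le_compat_l; [left; apply exp_pos|]. pose proof (exp_ineq1_le (- x)). lra. }
  assert (Hp : 0 <= exp x ^ N <= 1).
  { split; [apply pow_le; left; apply exp_pos|].
    rewrite <- (pow1 N). apply pow_incr. split; [left; apply exp_pos|exact Hx1]. }
  rewrite Cmod_mult, Cmod_pow, <- Ex. simpl pow.
  pose proof (exp_pos x).
  apply Rle_trans with (exp x * exp x ^ N * (B * exp (- INR N * x) + K * (- x))).
  { apply Rmult_le_compat_l; [|exact B1]. apply Rmult_le_pos; lra. }
  replace (exp x * exp x ^ N * (B * exp (- INR N * x) + K * - x)) with
    (exp x * B * (exp x ^ N * exp (- INR N * x)) + exp x ^ N * (K * (exp x * - x))) by ring.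
  rewrite Ep, Rmult_1_r. apply Rplus_le_compat.
  - nra.
  - apply Rle_trans with (1 * (K * 1)); [|lra].
    assert (0 <= exp x * - x) by (apply Rmult_le_pos; lra).
    apply Rmult_le_compat; try lra.
    + apply Rmult_le_pos; assumption.
    + apply Rmult_le_compat_l; assumption.
Qed.

(** * From growth to the type of the singularity *)

(** The quotient extends by k'(0); that the extension is differentiable at 0 is
    the Taylor expansion of order 2 of [k], obtained from the differentiability
    of k' by the mean value inequality. *)
Lemma divide_zero (k : C -> C) (rad : R) :
  0 < rad -> differentiable_on_disc k 0 rad -> k 0%C = 0%C ->
  exists k1, differentiable_on_disc k1 0 rad /\
    forall z : C, z <> 0%C -> (k1 z = k z / z)%C.
Proof.
  intros Hrad Hk Hk0.
  set (al := C_derive k 0).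
  destruct (derivative_differentiable k 0 rad Hrad Hk) as [be Hbe].
  set (k1 := fun z : C => if excluded_middle_informative (z = 0%C) then al else (k z / z)%C).
  assert (K1 : forall z : C, z <> 0%C -> (k1 z = k z / z)%C).
  { intros z Hz. unfold k1. destruct excluded_middle_informative; [contradiction|reflexivity]. }
  assert (K0 : k1 0%C = al).
  { unfold k1. destruct excluded_middle_informative; [reflexivity|contradiction]. }
  exists k1. split; [|exact K1]. intros z Hz.
  destruct (classic (z = 0%C)) as [->|Hn].
  - exists (be / 2)%C. intros eps He.
    destruct (Hbe eps He) as [d [Hd Hw]]. exists (Rmin d rad).
    split; [apply Rmin_pos; assumption|]. intros w Hlt.
    pose proof (Rmin_l d rad). pose proof (Rmin_r d rad).
    replace (w - 0)%C with w in * by ring. rewrite K0.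
    destruct (classic (w = 0%C)) as [->|Hwn].
    { rewrite K0. replace (al - al - be / 2 * 0)%C with (RtoC 0) by ring.
      rewrite Cmod_0. lra. }
    rewrite (K1 w Hwn).
    (* remainder of the second order Taylor expansion of k at 0 *)
    set (E := fun z => (k z - (al * z + be / 2 * (z * z)))%C).
    assert (T : Cmod (E w - E 0%C) <= eps * Cmod w * Cmod (w - 0)).
    { assert (Hseg : forall t, 0 <= t <= 1 -> Cmod (0 + RtoC t * (w - 0)) <= Cmod w).
      { intros t Ht. replace (0 + RtoC t * (w - 0))%C with (RtoC t * w)%C by ring.
        rewrite Cmod_mult, Cmod_R, Rabs_pos_eq by lra. pose proof (Cmod_ge_0 w). nra. }
      apply (mean_value_ineq E (fun z => C_derive k z - C_derive k 0 - be * (z - 0))%C).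
      - intros t Ht. specialize (Hseg t Ht). set (v := (0 + RtoC t * (w - 0))%C) in *.
        eapply cder_eq.
        + apply (cder_minus k (fun z => al * z + be / 2 * (z * z))%C).
          * apply cder_derive, Hk. replace (v - 0)%C with v by ring. lra.
          * apply (cder_plus (fun z => al * z)%C (fun z => be / 2 * (z * z))%C).
            -- apply (cder_mult (fun _ => al) (fun z => z)); [apply cder_const|apply cder_id].
            -- apply (cder_mult (fun _ => be / 2)%C (fun z => z * z)%C); [apply cder_const|].
               apply (cder_mult (fun z => z) (fun z => z)); apply cder_id.
        + simpl. unfold al. field.
      - intros t Ht. specialize (Hseg t Ht). set (v := (0 + RtoC t * (w - 0))%C) in *.
        assert (Ev : (v - 0)%C = v) by ring.
        eapply Rle_trans; [apply Hw; rewrite Ev; lra|]. rewrite Ev.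
        apply Rmult_le_compat_l; lra. }
    replace (w - 0)%C with w in T by ring.
    replace (k w / w - al - be / 2 * w)%C with ((E w - E 0) / w)%C.
    + rewrite Cmod_div by exact Hwn. apply Rle_div_l; [apply Cmod_gt_0, Hwn|exact T].
    + unfold E. rewrite Hk0. field. exact Hwn.
  - destruct (Hk z Hz) as [e He]. apply Cmod_gt_0 in Hn.
    assert (D : cder (fun z => k z / z)%C z ((e * z - k z * 1) / (z * z))%C).
    { apply cder_div; [apply Cmod_gt_0, Hn|exact He|apply cder_id]. }
    eexists. apply (cder_ext_loc (fun z => k z / z)%C k1 z _ (Cmod z) Hn); [|exact D].
    intros w Hw. symmetry. apply K1. intros ->.
    replace (0 - z)%C with (- z)%C in Hw by ring. rewrite Cmod_opp in Hw. lra.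
Qed.

(** Cancel factors z one at a time: either all n of them cancel and [k] itself
    extends [g], or some quotient is non-zero at 0 and [g] has a pole. *)
Lemma removable_or_pole (g : C -> C) (n : nat) : forall (k : C -> C),
  isolated_singularity g 0 ->
  differentiable_on_disc k 0 1 ->
  (forall z, 0 < Cmod z < 1 -> (k z = z ^ n * g z)%C) ->
  removable_singularity g 0 \/ pole g 0.
Proof.
  induction n as [|n IH]; intros k Hg Hk E.
  - left. split; [exact Hg|]. exists k. split.
    + apply locally_Cmod. exists 1. split; [lra|]. intros w Hw.
      apply C_differentiable_cder, Hk, Hw.
    + apply locally'_Cmod. exists 1. split; [lra|]. intros w Hw Hn.
      replace (w - 0)%C with w in Hw by ring.
      rewrite E by (split; [apply Cmod_gt_0, Hn|exact Hw]). simpl. ring.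
  - destruct (classic (k 0%C = 0%C)) as [H0|H0].
    + destruct (divide_zero k 1 Rlt_0_1 Hk H0) as [k1 [Hk1 E1]].
      apply (IH k1 Hg Hk1). intros z Hz.
      assert (z <> 0%C) by (apply Cmod_gt_0; lra).
      rewrite E1, E by assumption. simpl. field. assumption.
    + right. split; [exact Hg|].
      assert (Hm : 0 < Cmod (k 0%C)) by (apply Cmod_gt_0, H0).
      set (m := Cmod (k 0%C)) in *.
      destruct (Hk 0%C) as [e He]; [rewrite Cmod_self; lra|].
      destruct (cder_cont _ _ _ He (m / 2)) as [d [Hd Hw]]; [lra|].
      intros P [M HM]. apply locally'_Cmod.
      assert (HM1 : 0 < Rabs M + 1) by (pose proof (Rabs_pos M); lra).
      assert (Hq : 0 < m / (2 * (Rabs M + 1))) by (apply Rdiv_lt_0_compat; lra).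
      set (q := m / (2 * (Rabs M + 1))) in *.
      exists (Rmin (Rmin d 1) q). split; [repeat apply Rmin_pos; lra|].
      intros z Hz Hn. apply HM.
      pose proof (Rmin_l (Rmin d 1) q). pose proof (Rmin_r (Rmin d 1) q).
      pose proof (Rmin_l d 1). pose proof (Rmin_r d 1).
      specialize (Hw z ltac:(lra)).
      replace (z - 0)%C with z in * by ring.
      apply Cmod_gt_0 in Hn.
      pose proof (Cmod_le_add (k 0%C) (k z)) as T. rewrite Cmod_minus_sym in T. fold m in T.
      assert (T2 : m / 2 < Cmod (k z)) by lra.
      rewrite E in T2 by lra. rewrite Cmod_mult, Cmod_pow in T2. simpl pow in T2.
      assert (Hp : 0 <= Cmod z ^ n <= 1).
      { split; [apply pow_le; lra|]. rewrite <- (pow1 n). apply pow_incr. lra. }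
      pose proof (Cmod_ge_0 (g z)) as Hgz.
      assert (T3 : m / 2 < q * Cmod (g z)).
      { eapply Rlt_le_trans; [exact T2|]. apply Rmult_le_compat_r; [exact Hgz|]. nra. }
      assert (T4 : m / 2 = q * (Rabs M + 1)) by (unfold q; field; lra).
      rewrite T4 in T3. apply Rmult_lt_reg_l in T3; [|exact Hq].
      pose proof (Rle_abs M). lra.
Qed.

Theorem proposition4p2 :
  forall (c z0 : C) (g : C -> C),
    c <> 0%C ->
    punctured_disc z0 ->
    holomorphic_on punctured_disc g ->
    (forall theta : R, 0 <= theta <= 2 * PI ->
     forall phi : C -> C,
       phi_branch (slit_disc theta) c z0 g phi ->
       injective_on (slit_disc theta) phi) ->
    ~ essential_singularity g 0%C.
Proof.
  intros c z0 g _ [_ Hz0] Hg Hinj (Hiso & Hrem & Hpole).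
  destruct (polar_form z0 Hz0) as [y0 [_ E0]].
  set (l0 := ((ln (Cmod z0), y0) : C)) in *.
  destruct (polynomial_growth c l0 g Hg (lifted_injective c z0 l0 g E0 Hinj))
    as (N & B & HB & H).
  (* two more factors z than boundedness requires give k the derivative 0 at 0 *)
  set (k := fun z => (z * z * (z ^ N * g z))%C).
  assert (Hor : removable_singularity g 0 \/ pole g 0); [|tauto].
  apply (removable_or_pole g (S (S N)) k Hiso).
  - intros z Hz. destruct (classic (z = 0%C)) as [->|Hn].
    + exists 0%C. intros eps He.
      assert (Hq : 0 < eps / (B + 1)) by (apply Rdiv_lt_0_compat; lra).
      exists (Rmin (exp (-1)) (eps / (B + 1))).
      split; [apply Rmin_pos; [apply exp_pos|exact Hq]|]. intros w Hw.
      pose proof (Rmin_l (exp (-1)) (eps / (B + 1))).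
      pose proof (Rmin_r (exp (-1)) (eps / (B + 1))).
      replace (k w - k 0 - 0 * (w - 0))%C with (k w) by (unfold k; ring).
      replace (w - 0)%C with w in * by ring.
      destruct (classic (w = 0%C)) as [->|Hwn].
      { replace (k 0%C) with (RtoC 0) by (unfold k; ring). rewrite Cmod_0. lra. }
      apply Cmod_gt_0 in Hwn. specialize (H w ltac:(lra)).
      unfold k. rewrite 2!Cmod_mult. 
      replace (eps * Cmod w) with (Cmod w * (eps / (B + 1)) * (B + 1)) by (field; lra).
      pose proof (Cmod_ge_0 (w ^ N * g w)).
      apply Rmult_le_compat; try lra.
      * apply Rmult_le_pos; lra.
      * apply Rmult_le_compat_l; lra.
    + assert (P : punctured_disc z).
      { split; [|exact Hn]. unfold unit_disc. replace z with (z - 0)%C by ring. exact Hz. }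
      apply Hg, C_differentiable_cder in P. destruct P as [e He].
      destruct (cder_pow N z) as [e' He'].
      eexists. apply (cder_mult (fun z => z * z)%C (fun z => z ^ N * g z)%C).
      * apply (cder_mult (fun z => z) (fun z => z)); apply cder_id.
      * apply (cder_mult (fun z => z ^ N)%C g); [exact He'|exact He].
  - intros z _. unfold k. simpl. ring.
Qed.
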